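(* Let $X,Y,Z,W$ be locally convex Hausdorff topological vector spaces, $K\subset Y$ a proper closed convex cone with $\operatorname{int}K\ne\emptyset$, $P\subset W$ and $S\subset Z$ nonempty convex cones, $F\colon X\to Y^\infty$, $\kappa\colon W\to Y^\infty$, $H\colon X\to W^\infty$, $G\colon X\to Z^\infty$ proper mappings, $C\subset X$ nonempty, $A=C\cap G^{-1}(-S)$, and assume $A\cap\operatorname{dom}F\cap H^{-1}(\operatorname{dom}\kappa)\neq\emptyset$. Assume that $F$ is $K$-convex, $H$ is $P$-convex, $G$ is $S$-convex, $\kappa$ is $K$-convex and $(P,K)$-nondecreasing, and $C$ is convex. Let $$Z_0^3=\operatorname{lin}\big[\{(x,x,H(x),G(x)):x\in\operatorname{dom}H\cap\operatorname{dom}G\}-\operatorname{dom}F\times C\times\operatorname{dom}\kappa\times(-S)\big]\subset X\times X\times W\times Z,$$ and assume that for every $L\in\mathcal L(X,Y)$ there exist $y_L\in Y$ and a neighborhood $W_L$ of $(0_X,0_X,0_W,0_Z)$ such that for every $(x',x'',w,z)\in W_L\cap Z_0^3$ there is $x\in X$ with $x+x''\in C$, $G(x)+z\in-S$ and $F(x+x')+\kappa(H(x)+w)-L(x)\leqq_Ky_L$. Then stable strong duality holds for the pairs $(\mathrm{CCVP})-(\mathrm{CCVD}^3)$ and $(\mathrm{CCVP})-(\mathrm{CCVD}^3_\ell)$; that is, for every $L\in\mathcal L(X,Y)$, $$\operatorname{WInf}\{F(x)+(\kappa\circ H)(x)-L(x):x\in A\}=\operatorname{WMax}D_L=\operatorname{WMax}D_L^+,$$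 where $D_L$ is the union over $L',L''\in\mathcal L(X,Y)$, $T_1\in\operatorname{dom}\kappa^*$, $T_2\in\mathcal L_+^w(S,K)$ of the sets $$-\big[F^*(L')\uplus(T_1\circ H+T_2\circ G)^*(L-L'-L'')\uplus I_C^*(L'')\uplus\kappa^*(T_1)\uplus I_{-S}^*(T_2)\big],$$ and $D_L^+$ is the union over $L',L''\in\mathcal L(X,Y)$, $T_1\in\operatorname{dom}\kappa^*\cap\mathcal L_+(P,K)$, $T_2\in\mathcal L_+(S,K)$ of the sets $$-\big[F^*(L')\uplus(T_1\circ H+T_2\circ G)^*(L-L'-L'')\uplus I_C^*(L'')\uplus\kappa^*(T_1)\big].$$
   Context: Ordering: $K$ proper means $K\neq Y$. $y_1\leqq_Ky_2$ iff $y_1-y_2\in-K$; $y_1<_K y_2$ iff $y_1-y_2\in-\operatorname{int}K$. $Y^\infty=Y\cup\{+\infty_Y\}$, $Y^\bullet=Y\cup\{\pm\infty_Y\}$, with $-\infty_Y<_Ky<_K+\infty_Y$ for $y\in Y$, $-\infty_Y<_K+\infty_Y$, $-(\pm\infty_Y)=\mp\infty_Y$, $y+(+\infty_Y)=+\infty_Y$ for $y\in Y^\infty$, $M+\{+\infty_Y\}=\{+\infty_Y\}$ for $M\subset Y$; $y\leqq_K+\infty_Y$ for all $y\in Y^\infty$ and $+\infty_Y\not\leqq_Ky$ for $y\in Y$. Similarly $W^\infty=W\cup\{+\infty_W\}$, $Z^\infty=Z\cup\{+\infty_Z\}$. For $M\subset Y^\bullet$: $\operatorname{WSup}M$ is the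 set of $\bar v\in Y^\bullet$ such that $\bar v\not<_Kv$ for all $v\in M$ and for every $\tilde v\in Y^\bullet$ with $\tilde v<_K\bar v$ there is $v\in M$ with $\tilde v<_Kv$; $\operatorname{WInf}M=-\operatorname{WSup}(-M)$; $\operatorname{WMax}M=M\cap\operatorname{WSup}M$. $\operatorname{dom}$ is the set of points where a mapping is not $+\infty$; a mapping into $Y^\infty$, $W^\infty$, $Z^\infty$ is proper if its domain is nonempty. A mapping $E$ is $Q$-convex ($Q$ a convex cone in the target space) if $\{(x,y):x\in\operatorname{dom}E,\ y\in E(x)+Q\}$ is convex. $\kappa$ is $(P,K)$-nondecreasing if $w_1-w_2\in-P$ implies $\kappa(w_1)\leqq_K\kappa(w_2)$. $\kappa(+\infty_W)=+\infty_Y$. $\mathcal L(\cdot,\cdot)$ denotes continuous linear maps. For $T\in\mathcal L(Z,Y)$, $(T\circ G)(x)=T(G(x))$ if $G(x)\in Z$ and $+\infty_Y$ otherwise; likewise $T\circ H$. $I_D(x)=0_Y$ if $x\in D$, $+\infty_Y$ otherwise. For $E\colon X\to Y^\infty$, $E^*(L)=\operatorname{WSup}\{L(x)-E(x):x\in X\}$ and $\operatorname{dom}E^*=\{L:E^*(L)\neq\{+\infty_Y\}\}$; likewise for mappings on $W$, $Z$ ($\kappa^*$, $I_{-S}^*$). $\mathcal L_+(S,K)=\{T\in\mathcal L(Z,Y):T(S)\subset K\}$, $\mathcal L_+^w(S,K)=\{T\in\mathcal L(Z,Y):T(S)\cap(-\operatorname{int}K)=\emptyset\}$, $\mathcal L_+(P,K)$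 analogously. $\operatorname{lin}$ is the linear hull. $\mathcal P_p(Y)$ is the collection of $U\subset Y$ such that $Y$ is the disjoint union of $U-\operatorname{int}K$, $U$, $U+\operatorname{int}K$; for $U,V\in\mathcal P_p(Y)\cup\{\{+\infty_Y\}\}$, $U\uplus V=\operatorname{WSup}(U+V)$ (a commutative, associative operation; the conjugate values above belong to this collection). $(\mathrm{CCVP})$ is the problem $\operatorname{WInf}\{F(x)+(\kappa\circ H)(x):x\in C,\ G(x)\in-S\}$; $(\mathrm{CCVD}^3)$ and $(\mathrm{CCVD}^3_\ell)$ are its Fenchel-Lagrange duals, obtained from $D_L$ and $D_L^+$ with $L=0$.
   Formalization: The formal theorem additionally assumes that dom κ* is nonempty, which the stated conclusion forces; without it the claim fails, e.g. for κ a discontinuous linear functional with H the identity, F = G = 0, P = S = {0} and C = X. *)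

(* Defs.v *)
(* MathComp / MathComp-Analysis *)
From HB Require Import structures.
From mathcomp Require Import all_boot all_order all_algebra.
From mathcomp Require Import all_classical all_reals all_analysis.

Set Implicit Arguments.
Unset Strict Implicit.
Unset Printing Implicit Defensive.

Import GRing.Theory Num.Theory.

Local Open Scope classical_set_scope.
Local Open Scope ring_scope.

(* The enlarged space Y^oo = Y u {+oo} is [option Y], with [None] as +oo, and
   Y^. = Y u {-oo, +oo} is [\bar Y].  On the carrier [\bar Y] only the library's
   opposite and addition are used; the order is the one induced by K below. *)

Definition top_ext {Y : Type} (u : option Y) : \bar Y :=
  if u is Some y then y%:E else +oo%E.

Definition top_add {Y : nmodType} (u v : option Y) : option Y :=
  match u, v with
  | Some a, Some b => Some (a + b)
  | _, _ => None
  end.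

(* v belongs to Y and lies in D, for v in Y^oo *)
Definition top_mem {Y : Type} (D : set Y) (v : option Y) : Prop :=
  if v is Some y then D y else False.

Definition opp_set {V : zmodType} (A : set V) : set V := -%R @` A.

Section cones.
Context {R : realType} {V : tvsType R}.

(* The weaker of the two usual conventions: 0 need not belong to the cone. *)
Definition cone (Q : set V) : Prop :=
  forall (t : R) x, 0 < t -> Q x -> Q (t *: x).

Definition convex_cone (Q : set V) : Prop := cone Q /\ convex_set Q.

Definition cone_le (Q : set V) (u v : V) : Prop := opp_set Q (u - v).

Definition cone_lt (Q : set V) (u v : V) : Prop := opp_set Q° (u - v).

Definition top_le (Q : set V) (u v : option V) : Prop :=
  match u, v with
  | _, None => True
  | None, Some _ => False
  | Some a, Some b => cone_le Q a b
  end.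

Definition bar_lt (Q : set V) (u v : \bar V) : Prop :=
  match u, v with
  | a%:E, b%:E => cone_lt Q a b
  | -oo%E, -oo%E => False
  | -oo%E, _ => True
  | a%:E, +oo%E => True
  | _, _ => False
  end.

Definition wsup (K : set V) (M : set (\bar V)) : set (\bar V) :=
  [set v | (forall u, M u -> ~ bar_lt K v u) /\
           (forall t, bar_lt K t v -> exists2 u, M u & bar_lt K t u)].

Definition winf (K : set V) (M : set (\bar V)) : set (\bar V) :=
  -%E @` wsup K (-%E @` M).

Definition wmax (K : set V) (M : set (\bar V)) : set (\bar V) :=
  M `&` wsup K M.

Definition wsum (K : set V) (M N : set (\bar V)) : set (\bar V) :=
  wsup K [set (u + v)%E | u in M & v in N].

Definition linear_hull (A : set V) : set V :=
  [set v | exists (n : nat) (c : 'I_n -> R) (a : 'I_n -> V),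
     (forall i, A (a i)) /\ v = \sum_(i < n) c i *: a i].

End cones.

Section mappings.
Context {R : realType} {U V : tvsType R}.

Definition cont_lin : set (U -> V) := [set T | linear T /\ continuous T].

Definition dom (E : U -> option V) : set U := [set x | E x <> None].

Definition proper_map (E : U -> option V) : Prop := dom E !=set0.

Definition cone_convex (Q : set V) (E : U -> option V) : Prop :=
  convex_set ([set p | exists2 e, E p.1 = Some e & Q (p.2 - e)]
              : set (U * V)%type).

Definition cone_nondecreasing (P : set U) (K : set V) (E : U -> option V)
  : Prop := forall w1 w2, cone_le P w1 w2 -> top_le K (E w1) (E w2).

Definition indicator (D : set U) (x : U) : option V :=
  if x \in D then Some 0 else None.

Definition conjugate (K : set V) (E : U -> option V) (T : U -> V)
  : set (\bar V) := wsup K [set ((T x)%:E - top_ext (E x))%E | x in setT].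

Definition dom_conjugate (K : set V) (E : U -> option V) : set (U -> V) :=
  cont_lin `&` [set T | conjugate K E T <> [set +oo%E]].

Definition lin_pos (S : set U) (K : set V) : set (U -> V) :=
  cont_lin `&` [set T | T @` S `<=` K].

Definition lin_wpos (S : set U) (K : set V) : set (U -> V) :=
  cont_lin `&` [set T | T @` S `&` opp_set K° = set0].

End mappings.

Section problem.
Context {R : realType} {X Y Z W : tvsType R}.
Variables (K : set Y) (P : set W) (S : set Z) (C : set X).
Variables (F : X -> option Y) (kappa : W -> option Y).
Variables (H : X -> option W) (G : X -> option Z).

(* kappa o H, with kappa (+oo_W) = +oo_Y *)
Definition kappa_comp (x : X) : option Y := obind kappa (H x).

Definition feasible : set X := C `&` [set x | top_mem (opp_set S) (G x)].

(* The value of WInf {F + kappa o H - L} over the feasible set. *)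
Definition primal (L : X -> Y) : set (\bar Y) :=
  winf K [set top_ext (top_add (top_add (F x) (kappa_comp x)) (Some (- L x)))
         | x in feasible].

(* T1 o H + T2 o G *)
Definition lin_comp (T1 : W -> Y) (T2 : Z -> Y) (x : X) : option Y :=
  top_add (omap T1 (H x)) (omap T2 (G x)).

Definition dual (L : X -> Y) : set (\bar Y) :=
  \bigcup_(L1 in cont_lin) \bigcup_(L2 in cont_lin)
  \bigcup_(T1 in dom_conjugate K kappa) \bigcup_(T2 in lin_wpos S K)
    (-%E @` (wsum K (wsum K (wsum K (wsum K
       (conjugate K F L1)
       (conjugate K (lin_comp T1 T2) (L \- L1 \- L2)))
       (conjugate K (indicator C) L2))
       (conjugate K kappa T1))
       (conjugate K (indicator (opp_set S)) T2))).

Definition dual_pos (L : X -> Y) : set (\bar Y) :=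
  \bigcup_(L1 in cont_lin) \bigcup_(L2 in cont_lin)
  \bigcup_(T1 in dom_conjugate K kappa `&` lin_pos P K)
  \bigcup_(T2 in lin_pos S K)
    (-%E @` (wsum K (wsum K (wsum K
       (conjugate K F L1)
       (conjugate K (lin_comp T1 T2) (L \- L1 \- L2)))
       (conjugate K (indicator C) L2))
       (conjugate K kappa T1))).

Definition diag_graph : set (X * X * W * Z)%type :=
  [set p | exists x w z, [/\ H x = Some w, G x = Some z & p = (x, x, w, z)]].

Definition Z03 : set (X * X * W * Z)%type :=
  linear_hull
    [set p - q | p in diag_graph
               & q in dom F `*` C `*` dom kappa `*` opp_set S].

Definition regularity (L : X -> Y) : Prop :=
  exists (yL : Y) (N : set (X * X * W * Z)%type),
    nbhs (0, 0, 0, 0) N /\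
    forall x1 x2 w z, (N `&` Z03) (x1, x2, w, z) ->
      exists x, [/\ C (x + x2),
        top_mem (opp_set S) (omap (+%R^~ z) (G x)) &
        top_le K
          (top_add (top_add (F (x + x1)) (obind kappa (omap (+%R^~ w) (H x))))
                   (Some (- L x)))
          (Some yL)].

End problem.

(* Main.v *)
(* Scalarization and one separation.  If [v] is a finite point of the primal
   infimum, the set [perturbed] of perturbed values is convex and never meets
   [v - int K] over the zero perturbation; the regularity condition bounds it
   over a relative neighbourhood of [0], so [(0, v)] is separated from it by
   [(g, h)] with [g] continuous on [X * X * W * Z] and [h] positive on [K],
   [h k = 1].  The components of [- g], composed with [t |-> t *: k], are the
   optimal [L1], [L2], [T1], [T2].  On the side of weak suprema, [wsup K M]
   depends only on [below K M], and [below] is unchanged by [wsup] and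
   distributes over sums, so each dual value is the weak supremum of a plain
   sum of sets.  When the primal value is [-oo], the only issue is to find a
   [T1] that is positive on [P], and it comes from scalarizing an arbitrary
   element of [dom_conjugate K kappa]. *)
Require Import Defs.
From mathcomp Require Import all_boot all_order all_algebra.
From mathcomp Require Import all_classical all_reals all_analysis.
From mathcomp Require Import ring lra.

Set Implicit Arguments.
Unset Strict Implicit.
Unset Printing Implicit Defensive.

Import Order.TTheory GRing.Theory Num.Theory.

Local Open Scope classical_set_scope.
Local Open Scope ring_scope.

(** * Positive functionals *)

Lemma convex_set_comb (R : realType) (V : lmodType R) (A : set V)
    (x y : V) (a b : R) :
  convex_set A -> A x -> A y -> 0 <= a -> 0 <= b -> a + b = 1 ->
  A (a *: x + b *: y).
Proof.
move=> cA Ax Ay a0 b0 ab1.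
have a1 : a <= 1 by lra.
have /set_mem := cA x y (Itv01 a0 a1) (mem_set Ax) (mem_set Ay).
suff -> : b = 1 - a by [].
by lra.
Qed.

Section positive_functional.
Context {R : realType} {V : lmodType R}.
Variables (Q : set V) (e : V).

Let pcone (B : set V) : Prop :=
  [/\ forall x y, B x -> B y -> B (x + y),
      forall (t : R) x, 0 < t -> B x -> B (t *: x) & ~ B (- e)].

(* A cone that is maximal among those avoiding [- e] contains [u] or [- u] for
   every [u], so [sup {s | u - s *: e \in cone}] is additive in [u]. *)
Lemma pos_functional :
  Q 0 -> (forall x y, Q x -> Q y -> Q (x + y)) ->
  (forall (t : R) x, 0 < t -> Q x -> Q (t *: x)) -> ~ Q (- e) ->
  (forall u, exists t : R, Q (u + t *: e)) ->
  exists f : V -> R, [/\ scalar f, forall u, Q u -> 0 <= f u & f e = 1].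
Proof.
move=> Q0 QD QZ Qe Qabs.
(* Zorn is applied to the part [A] added to [Q], not to the cone itself: the union of the empty
   chain is then still admissible, because [Q] alone is. *)
have [|A [[AD AZ Ae] Amax]] := @Zorn_bigcup V (fun A => pcone (Q `|` A)).
  move=> F Fc Ftot.
  have sub X : F X -> Q `|` X `<=` Q `|` \bigcup_(X in F) X.
    by move=> FX x [?|?]; [left|right; exists X].
  split.
  - move=> x y [Qx|[X FX Xx]] [Qy|[X' FX' Xy]].
    + by left; exact: QD.
    + have [h _ _] := Fc _ FX'; apply: sub FX' _ _.
      by apply: h; [left|right].
    + have [h _ _] := Fc _ FX; apply: sub FX _ _.
      by apply: h; [right|left].
    + have [XX'|X'X] := Ftot _ _ FX FX'.
      * have [h _ _] := Fc _ FX'; apply: sub FX' _ _.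
        by apply: h; right => //; exact: XX'.
      * have [h _ _] := Fc _ FX; apply: sub FX _ _.
        by apply: h; right => //; exact: X'X.
  - move=> t x t0 [Qx|[X FX Xx]]; first by left; exact: QZ.
    have [_ h _] := Fc _ FX; apply: sub FX _ _.
    by apply: h => //; right.
  - by move=> [//|[X FX Xx]]; have [_ _] := Fc _ FX; apply; right.
pose B := Q `|` A.
have B0 : B 0 by left.
have Btot u : B u \/ B (- u).
  (* If neither [u] nor [- u] is in [B], then [- e = b + t *: u] and [- e = b' - t' *: u]. Weighting
     these by [t'] and [t] cancels [u] and puts [- e] in [B]. The claim [ext] holds because
     otherwise [B] could be enlarged by the ray of [v]. *)
  suff ext v : ~ B v -> exists2 b, B b & exists2 t : R, 0 < t & - e = b + t *: v.
    apply: contrapT => /not_orP[/ext[b Bb [t t0 bE]] /ext[b' Bb' [t' t'0 b'E]]].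
    apply: Ae.
    have -> : - e = (t + t')^-1 *: (t' *: b + t *: b').
      have -> : t' *: b + t *: b' = t' *: (- e) + t *: (- e).
        rewrite {1}bE {1}b'E !scalerDr addrACA scalerN scalerA scalerN scalerA.
        by rewrite [t' * t]mulrC subrr addr0.
      rewrite -scalerDl scalerA [t' + t]addrC mulVf ?scale1r//.
      by rewrite gt_eqF// addr_gt0.
    apply: (AZ); first by rewrite invr_gt0 addr_gt0.
    by apply: AD; exact: AZ.
  move=> nBv; pose B' := [set x | exists2 b, B b &
    exists2 t : R, 0 <= t & x = b + t *: v].
  have BB' : B `<=` B'.
    by move=> b Bb; exists b => //; exists 0 => //; rewrite scale0r addr0.
  have [[b Bb [t t0 bE]]|nB'e] := pselect (B' (- e)); last first.
    exfalso; apply: (Amax B').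
      split; first by move=> x Ax; apply: BB'; right.
      by move=> /(_ v) h; apply: nBv; right; apply: h; exists 0 => //;
        exists 1 => //; rewrite add0r scale1r.
    have -> : Q `|` B' = B'.
      by apply/setUidPr => x Qx; apply: BB'; left.
    split=> //.
    - move=> _ _ [b Bb [t t0 ->]] [b' Bb' [t' t'0 ->]]; exists (b + b').
        exact: AD.
      by exists (t + t'); [exact: addr_ge0|rewrite addrACA scalerDl].
    - move=> s _ s0 [b Bb [t t0 ->]]; exists (s *: b); first exact: AZ.
      by exists (s * t); [exact: mulr_ge0 (ltW s0) t0|rewrite scalerDr scalerA].
  exists b => //; exists t => //; rewrite lt_neqAle t0 andbT eq_sym.
  by apply/eqP => t0'; apply: Ae; rewrite bE t0' scale0r addr0.
have Be : B e by have [//|] := Btot e.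
have BZ0 (t : R) x : 0 <= t -> B x -> B (t *: x).
  rewrite le_eqVlt => /orP[/eqP <- _|/AZ]; [by rewrite scale0r|exact].
have Bneg t : B (t *: e) -> 0 <= t.
  move=> Bt; rewrite leNgt; apply/negP => t0; apply: Ae.
  have -> : - e = (- t)^-1 *: (t *: e).
    by rewrite scalerA invrN mulNr mulVf ?lt_eqF// scaleN1r.
  by apply: AZ; rewrite // invr_gt0 oppr_gt0.
pose D u := [set s : R | B (u - s *: e)].
have hD u : has_sup (D u).
  split.
    by have [t Qt] := Qabs u; exists (- t); rewrite /D/= scaleNr opprK; left.
  have [t Qt] := Qabs (- u); exists t => s Ds.
  have /Bneg : B ((t - s) *: e).
    have -> : (t - s) *: e = (- u + t *: e) + (u - s *: e).
      by rewrite scalerBl addrACA addNr add0r.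
    by apply: AD => //; left.
  by rewrite subr_ge0.
pose f u := sup (D u).
(* The supremum need not be attained, since [B] is not known to be closed. Hence only strict
   inequalities give membership in [B], and additivity is proved up to [eps]. *)
have f_lt u s : s < f u -> B (u - s *: e).
  move=> /(sup_gt (hD u).1)[s' Ds' ss'].
  have -> : u - s *: e = (u - s' *: e) + (s' - s) *: e.
    by rewrite scalerBl addrA subrK.
  by apply: AD => //; apply: BZ0 => //; rewrite subr_ge0 ltW.
have f_gt u s : f u < s -> B (s *: e - u).
  move=> fs; have [|] := Btot (u - s *: e); last by rewrite opprB.
  by move=> Ds; have := ub_le_sup (hD u).2 Ds; rewrite leNgt fs.
have f_ge u s : B (u - s *: e) -> s <= f u.
  by move=> Ds; exact: (ub_le_sup (hD u).2 Ds).
have f_le u s : B (s *: e - u) -> f u <= s.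
  move=> Bs; apply: ge_sup; first exact: (hD u).1.
  move=> s' Ds'; rewrite -subr_ge0; apply: Bneg.
  by rewrite scalerBl -(subrK u (s *: e)) -addrA; apply: AD.
have fD u v : f (u + v) = f u + f v.
  apply/eqP; rewrite eq_le; apply/andP; split; apply/ler_addgt0Pr => eps eps0.
    have -> : f u + f v + eps = (f u + eps / 2) + (f v + eps / 2) by lra.
    apply: f_le; rewrite scalerDl opprD addrACA.
    by apply: AD; apply: f_gt; lra.
  rewrite -lerBlDr.
  have -> : f u + f v - eps = (f u - eps / 2) + (f v - eps / 2) by lra.
  apply: f_ge; rewrite scalerDl opprD addrACA.
  by apply: AD; apply: f_lt; lra.
have f0 : f 0 = 0 by have := fD 0 0; rewrite addr0; lra.
have fN u : f (- u) = - f u by have := fD u (- u); rewrite subrr f0; lra.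
have fZ_ge t u : 0 < t -> t * f u <= f (t *: u).
  move=> t0; rewrite -ler_pdivlMl//; apply/ler_addgt0Pr => eps eps0.
  rewrite -lerBlDr ler_pdivlMl//; apply: f_ge.
  rewrite -scalerA -scalerBr; apply: AZ => //; apply: f_lt; lra.
have fZp t u : 0 < t -> f (t *: u) = t * f u.
  move=> t0; apply/eqP; rewrite eq_le fZ_ge// andbT.
  have := @fZ_ge t^-1 (t *: u); rewrite invr_gt0 => /(_ t0).
  by rewrite scalerA mulVf ?gt_eqF// scale1r ler_pdivrMl.
have fZ t u : f (t *: u) = t * f u.
  have [t0|t0|->] := ltgtP t 0; last by rewrite scale0r mul0r f0.
  - by rewrite -[t]opprK [in LHS]scaleNr fN fZp ?oppr_gt0// !mulNr.
  - exact: fZp.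
exists f; split.
- by move=> a u v; rewrite fD fZ.
- by move=> u Qu; apply: f_ge; rewrite scale0r subr0; left.
- apply/eqP; rewrite eq_le; apply/andP; split.
    by apply: f_le; rewrite scale1r subrr.
  by apply: f_ge; rewrite scale1r subrr.
Qed.

End positive_functional.

(** * Cones with nonempty interior *)

(** Continuity of [s |-> u + s *: y] at [0]. Most later topological arguments about [K] reduce to
    this one-dimensional room around an interior point. *)
Lemma interior_line (R : realType) (Y : tvsType R) (A : set Y) (u y : Y) :
  A° u -> exists2 e : R, 0 < e & A° (u + e *: y).
Proof.
move=> Au.
have cf : (fun s : R^o => u + s *: y) @ (0 : R^o) --> u + 0 *: y.
  apply: (@continuous_comp R^o (Y * Y)%type Y (fun s => (u, s *: y))
    (fun x => x.1 + x.2)); last exact: add_continuous.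
  apply: (@cvg_pair _ _ _ _ (nbhs u) (nbhs (0 *: y))); first exact: cvg_cst.
  apply: (@continuous_comp R^o (R^o * Y)%type Y (fun s => (s, y))
    (fun x => x.1 *: x.2)); last exact: scale_continuous.
  apply: (@cvg_pair _ _ _ _ (nbhs (0 : R^o)) (nbhs y)); first exact: cvg_id.
  exact: cvg_cst.
have : nbhs (u + 0 *: y) A°.
  by rewrite scale0r addr0; apply: open_nbhs_nbhs; split => //; exact: open_interior.
move=> /cf h.
have /nbhs_ballP[e /= e0 he] : nbhs (0 : R^o) [set s | A° (u + s *: y)] := h.
exists (e / 2); first by rewrite divr_gt0.
apply: he; rewrite -ball_normE /= sub0r normrN gtr0_norm ?divr_gt0//.
by rewrite ltr_pdivrMr// ltr_pMr// ltr1n.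
Qed.

Section cone_facts.
Context {R : realType} {Y : tvsType R}.
Variable K : set Y.
Hypotheses (K_closed : closed K) (K_cone : convex_cone K).

Lemma cone_addr x y : K x -> K y -> K (x + y).
Proof.
move=> Kx Ky; have [KZ Kc] := K_cone.
have -> : x + y = 2%:R *: (2%:R^-1 *: x + 2%:R^-1 *: y).
  by rewrite -scalerDr scalerA divff ?scale1r.
apply: KZ => //; apply: convex_set_comb => //; lra.
Qed.

Lemma interior_cone_scale (t : R) x : 0 < t -> K° x -> K° (t *: x).
Proof.
move=> t0 Kx; have [KZ _] := K_cone.
have := @nbhsZ R Y K t x; rewrite gt_eqF// => /(_ isT Kx).
by apply: filterS => _ [z Kz <-]; exact: KZ.
Qed.

Lemma interior_cone_addr x y : K° x -> K y -> K° (x + y).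
Proof.
move=> Kx Ky; rewrite addrC.
have := @nbhsB R Y K x y Kx.
by apply: filterS => _ [z Kz <-]; exact: cone_addr.
Qed.

(** [cone] does not put [0] in the set; here [0] is recovered as the limit of [s *: k] for [s]
    decreasing to [0]. *)
Lemma closed_cone0 : K !=set0 -> K 0.
Proof.
move=> [k Kk]; have [KZ _] := K_cone.
rewrite (closure_id K).1// => B B0.
have cf : (fun s : R^o => s *: k) @ (0 : R^o) --> 0 *: k.
  apply: (@continuous_comp R^o (R^o * Y)%type Y (fun s => (s, k))
    (fun x => x.1 *: x.2)); last exact: scale_continuous.
  apply: (@cvg_pair _ _ _ _ (nbhs (0 : R^o)) (nbhs k)); first exact: cvg_id.
  exact: cvg_cst.
have : nbhs (0 *: k) B by rewrite scale0r.
move=> /cf h.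
have /nbhs_ballP[e /= e0 he] : nbhs (0 : R^o) [set s | B (s *: k)] := h.
exists ((e / 2) *: k); split; first by apply: KZ; rewrite // divr_gt0.
apply: he; rewrite -ball_normE /= sub0r normrN gtr0_norm ?divr_gt0//.
by rewrite ltr_pdivrMr// ltr_pMr// ltr1n.
Qed.

(** If [0] were interior, every vector would be a positive multiple of a small vector of [K]. This
    is the form in which properness of [K] is used. *)
Lemma interior_cone0 : K <> setT -> ~ K° 0.
Proof.
move=> KT K0; apply: KT; apply/seteqP; split => // y _; have [KZ _] := K_cone.
have [e e0] := interior_line y K0; rewrite add0r => /interior_subset Ke.
by rewrite -(scale1r y) -(mulVf (lt0r_neq0 e0)) -scalerA; apply: KZ;
  rewrite ?invr_gt0.
Qed.

(** An interior point is an order unit: a large enough multiple of it dominates any given vector. *)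
Lemma interior_cone_abs k y : K° k -> exists2 t : R, 0 < t & K° (t *: k + y).
Proof.
move=> Kk; have [e e0 Ke] := interior_line y Kk.
exists e^-1; first by rewrite invr_gt0.
have -> : e^-1 *: k + y = e^-1 *: (k + e *: y).
  by rewrite scalerDr scalerA mulVf ?gt_eqF// scale1r.
by apply: interior_cone_scale; rewrite ?invr_gt0.
Qed.

Lemma cone_ltE (u v : Y) : cone_lt K u v <-> K° (v - u).
Proof.
rewrite /cone_lt /opp_set; split.
  by move=> [w Kw e]; rewrite -opprB -e opprK.
by move=> Kw; exists (v - u); rewrite ?opprB.
Qed.

Lemma cone_leE (Q : set Y) (u v : Y) : cone_le Q u v <-> Q (v - u).
Proof.
rewrite /cone_le /opp_set; split.
  by move=> [w Kw e]; rewrite -opprB -e opprK.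
by move=> Kw; exists (v - u); rewrite ?opprB.
Qed.

Lemma cone_lt_le_trans a b c : cone_lt K a b -> K (c - b) -> cone_lt K a c.
Proof.
move=> /cone_ltE ab bc; apply/cone_ltE.
by rewrite -(subrK b c) -addrA addrC; exact: interior_cone_addr.
Qed.

Lemma cone_le_lt_trans a b c : K (b - a) -> cone_lt K b c -> cone_lt K a c.
Proof.
move=> ab /cone_ltE bc; apply/cone_ltE.
by rewrite -(subrK b c) -addrA; exact: interior_cone_addr.
Qed.

Lemma cone_lt_trans a b c : cone_lt K a b -> cone_lt K b c -> cone_lt K a c.
Proof.
by move=> ab /cone_ltE/interior_subset bc; exact: cone_lt_le_trans ab bc.
Qed.

Lemma bar_lt_trans a b c : bar_lt K a b -> bar_lt K b c -> bar_lt K a c.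
Proof. by case: a b c => [a| |] [b| |] [c| |] //=; exact: cone_lt_trans. Qed.

End cone_facts.

(** * Weak suprema *)

Definition below (R : realType) (Y : tvsType R) (K : set Y) (M : set (\bar Y)) :
  set (\bar Y) := [set t | exists2 u, M u & bar_lt K t u].

Section weak_supremum.
Context {R : realType} {Y : tvsType R}.
Variables (K : set Y) (k : Y).
Hypotheses (K_cone : convex_cone K) (K0 : K 0) (Kk : K° k).

Local Notation "a <K b" := (bar_lt K a b) (at level 70).
Local Notation below := (below K).

Lemma wsup_below M : wsup K M =
  [set v | ~ below M v /\ forall t, t <K v -> below M t].
Proof.
apply/seteqP; split => v [h1 h2]; split => //.
  by move=> [u Mu uv]; exact: (h1 u).
by move=> u Mu uv; apply: h1; exists u.
Qed.

Lemma wsup_ext M N : below M = below N -> wsup K M = wsup K N.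
Proof. by rewrite !wsup_below => ->. Qed.

Lemma below_down M s t : s <K t -> below M t -> below M s.
Proof. by move=> st [u Mu tu]; exists u => //; exact: (bar_lt_trans K_cone) tu. Qed.

Lemma below_le M (s t : Y) : K (t - s) -> below M t%:E -> below M s%:E.
Proof.
move=> st [[u| |] Mu //= tu]; [exists u%:E|exists +oo%E] => //=.
exact: cone_le_lt_trans tu.
Qed.

Lemma cone_lt_line (t : Y) (s : R) : 0 < s -> cone_lt K t (t + s *: k).
Proof.
by move=> s0; apply/cone_ltE; rewrite addrC addKr; exact: interior_cone_scale.
Qed.

(** The line through [t] in direction [k] enters and leaves [below M], and it crosses the boundary
    at the supremum of the parameters inside. The point [y1] makes that set of parameters nonempty
    and [y2] bounds it. *)
Lemma wsup_line M (t y1 y2 : Y) : below M y1%:E -> ~ below M y2%:E ->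
  exists s : R, wsup K M (t + s *: k)%:E.
Proof.
move=> y1M y2M; pose D := [set s : R | below M (t + s *: k)%:E].
have D0 : D !=set0.
  have [s s0 sk] := interior_cone_abs K_cone (y1 - t) Kk.
  exists (- s); apply: below_down y1M; apply/cone_ltE.
  by rewrite scaleNr opprB addrCA.
have Dub : has_ubound D.
  have [s s0 sk] := interior_cone_abs K_cone (t - y2) Kk.
  exists s => r Dr; rewrite leNgt; apply/negP => rs; apply: y2M.
  apply: below_down Dr; apply/cone_ltE.
  have -> : t + r *: k - y2 = s *: k + (t - y2) + (r - s) *: k.
    by rewrite scalerBl [RHS]addrC addrA subrK addrCA addrA.
  apply: interior_cone_addr => //.
  by apply: interior_subset; apply: interior_cone_scale; rewrite ?subr_gt0.
exists (sup D); rewrite wsup_below; split.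
  move=> [[u| |] Mu //=]; last first.
    by move=> _; apply: y2M; exists +oo%E.
  (* If the point at parameter [sup D] were strictly below [u], so would be the one at
     [sup D + e]. *)
  move=> /cone_ltE /(interior_line (- k))[e e0 he].
  suff : sup D + e <= sup D by lra.
  apply: ub_le_sup => //; exists u%:E => //=; apply/cone_ltE.
  by rewrite scalerDl addrA opprD addrA -scalerN.
move=> [w| |] //=.
  move=> /cone_ltE /(interior_line (- k))[e e0 he].
  have [s Ds sD] := sup_adherent e0 (conj D0 Dub).
  apply: below_down Ds => /=.
  apply: (@cone_lt_trans _ _ _ K_cone _ (t + (sup D - e) *: k)).
    by apply/cone_ltE; rewrite scalerBl addrA (addrAC _ _ (- w)) -scalerN.
  apply/cone_ltE; rewrite opprD addrACA subrr add0r -scalerBl.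
  by apply: interior_cone_scale; rewrite ?subr_gt0.
by move=> _; apply: below_down y1M.
Qed.

(** The nontrivial inclusion needs a weak supremum above a given [t] of [below M]. It is [+oo] when
    every finite point is below [M], and otherwise a boundary point on the line through [t]. *)
Lemma below_wsup M : below (wsup K M) = below M.
Proof.
apply/seteqP; split => t; first by move=> [v [_ h] /h].
move=> tM; case: (pselect (exists y : Y, ~ below M y%:E)); last first.
  move=> /forallNP allM.
  have Moo : wsup K M +oo%E.
    rewrite wsup_below; split; first by move=> [].
    move=> [y| |] //=; first by move=> _; apply: contrapT; exact: allM.
    by move=> _; apply: (@below_down _ _ (0 : Y)%:E) => //; apply: contrapT; exact: allM.
  by exists +oo%E => //; move: tM => [u _]; case: t.
move=> [y2 y2M].
have [y1 y1M] : exists y, below M y%:E.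
  move: tM => [[a| |] Mu]; first (exists (a - k); exists a%:E => //=).
    by apply/cone_ltE; rewrite subKr.
  by exists 0; exists +oo%E.
  by case: t.
case: t tM => [t| |] tM; last 2 first.
- by move: tM => [].
- by have [s hs] := wsup_line 0 y1M y2M; exists (0 + s *: k)%:E.
have [s hs] := wsup_line t y1M y2M; exists (t + s *: k)%:E => //=.
(* For [s <= 0] the boundary point lies under [t], hence in [below M], which a weak supremum
   avoids. *)
have [s0|s0] := ltP 0 s; first exact: cone_lt_line.
move: hs; rewrite wsup_below => -[+ _]; case; apply: below_le tM.
rewrite opprD addrA subrr add0r -scaleNr.
move: s0; rewrite le_eqVlt => /orP[/eqP -> |s0]; first by rewrite oppr0 scale0r.
by apply: interior_subset; apply: interior_cone_scale; rewrite ?oppr_gt0.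
Qed.

(** Dual use of the same line: as [t] is not below [M], the boundary is met at a parameter [s <= 0],
    so the weak supremum found there lies under [t] and strictly under [d]. *)
Lemma wsup_gap M t d : t <K d -> ~ below M t -> exists2 v, wsup K M v & v <K d.
Proof.
move=> td tM; case: (pselect (below M -oo%E)) => [[u Mu ou]|noM]; last first.
  exists -oo%E; last by case: t d td {tM} => [t| |] [d| |].
  by rewrite wsup_below; split => // -[].
case: t td tM => [t| |] td tM //; last by case: tM; exists u.
have [y1 y1M] : exists y, below M y%:E.
  case: u Mu ou => [a| |] Mu // _; last by exists 0; exists +oo%E.
  exists (a - k); exists a%:E => //=.
  by apply/cone_ltE; rewrite subKr.
have [s hs] := wsup_line t y1M tM; exists (t + s *: k)%:E => //.
have s0 : s <= 0.
  rewrite leNgt; apply/negP => s0; apply: tM.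
  by move: hs; rewrite wsup_below => -[_]; apply; exact: cone_lt_line.
case: d td => [d| |] //= td; apply: cone_le_lt_trans td => //.
rewrite opprD addrA subrr add0r -scaleNr.
move: s0; rewrite le_eqVlt => /orP[/eqP -> |s0]; first by rewrite oppr0 scale0r.
by apply: interior_subset; apply: interior_cone_scale; rewrite ?oppr_gt0.
Qed.

(** A strict gap under [u + v] can be shared between [u] and [v]. The library convention
    [+oo + -oo = -oo] is the right one here, since nothing is below [-oo]. *)
Lemma below_add M N : below [set (u + v)%E | u in M & v in N] =
  [set (a + b)%E | a in below M & b in below N].
Proof.
apply/seteqP; split => t.
  move=> [_ [u Mu [v Nv <-]]].
  case: u v Mu Nv => [u| |] [v| |] Mu Nv; rewrite /adde/=; case: t => [t| |] //.
  (* Half of the gap is taken off each summand. *)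
  - move=> /cone_ltE uv; pose h := 2%:R^-1 *: (u + v - t).
    have Kh : K° h by exact: interior_cone_scale.
    exists (u - h)%:E; first by exists u%:E => //; apply/cone_ltE; rewrite subKr.
    exists (v - h)%:E; first by exists v%:E => //; apply/cone_ltE; rewrite subKr.
    congr (_%:E); rewrite addrACA -opprD -scalerDl.
    by rewrite [X in X *: _](_ : _ = 1) ?scale1r ?subKr//; lra.
  - move=> _; exists -oo%E; first by exists u%:E.
    by exists -oo%E => //; exists v%:E.
  - move=> _; exists (u - k)%:E.
      by exists u%:E => //; apply/cone_ltE; rewrite subKr.
    exists (t - (u - k))%:E; first by exists +oo%E.
    by congr (_%:E); rewrite addrC subrK.
  - move=> _; exists -oo%E; first by exists u%:E.
    by exists -oo%E => //; exists +oo%E.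
  - move=> _; exists (t - (v - k))%:E; first by exists +oo%E.
    exists (v - k)%:E; last by congr (_%:E); rewrite subrK.
    by exists v%:E => //; apply/cone_ltE; rewrite subKr.
  - move=> _; exists -oo%E; first by exists +oo%E.
    by exists -oo%E => //; exists v%:E.
  - move=> _; exists t%:E; first by exists +oo%E.
    by exists 0%:E; [exists +oo%E|congr (_%:E); rewrite addr0].
  - move=> _; exists -oo%E; first by exists +oo%E.
    by exists -oo%E => //; exists +oo%E.
move=> [a [u Mu au] [b [v Nv bv] <-]]; exists (u + v)%E.
  by exists u => //; exists v.
case: a b u v au bv {Mu Nv} => [a| |] [b| |] [u| |] [v| |] //=.
move=> /cone_ltE au /cone_ltE bv; apply/cone_ltE.
by rewrite opprD addrACA; apply: interior_cone_addr => //; exact: interior_subset.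
Qed.

Lemma wsum_wsup M N : wsum K (wsup K M) (wsup K N) =
  wsup K [set (u + v)%E | u in M & v in N].
Proof. by apply: wsup_ext; rewrite !below_add !below_wsup. Qed.

End weak_supremum.

(** * Separation *)

Section scalar_theory.
Context {R : realType} {V : lmodType R} (f : V -> R).
Hypothesis f_lin : scalar f.

Lemma scalar_add u v : f (u + v) = f u + f v.
Proof. by have := f_lin 1 u v; rewrite scale1r mul1r. Qed.

Lemma scalar0 : f 0 = 0.
Proof. by have := scalar_add 0 0; rewrite addr0 => h; lra. Qed.

Lemma scalar_scale a u : f (a *: u) = a * f u.
Proof. by have := f_lin a u 0; rewrite !addr0 scalar0 addr0. Qed.

Lemma scalar_opp u : f (- u) = - f u.
Proof. by rewrite -scaleN1r scalar_scale mulN1r. Qed.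

Lemma scalar_sub u v : f (u - v) = f u - f v.
Proof. by rewrite scalar_add scalar_opp. Qed.

End scalar_theory.

(** A lower bound on a neighbourhood of [0] suffices: applied on [r N] and on [- r N] it bounds the
    functional on both sides. *)
Lemma scalar_continuous (R : realType) (U : tvsType R) (f : U -> R) (N : set U)
    (c : R) : scalar f -> nbhs 0 N -> (forall n, N n -> - c <= f n) ->
  continuous (f : U -> R^o).
Proof.
move=> f_lin N0 fN x; apply/cvgrPdist_lt => eps eps0.
pose r := eps / (2 * (`|c| + 1)).
have c0 : 0 < `|c| + 1 by rewrite ltr_wpDl.
have r0 : 0 < r by rewrite divr_gt0// mulr_gt0.
have rc : r * c < eps.
  rewrite /r mulrAC ltr_pdivrMr ?mulr_gt0//; have := ler_norm c; nra.
have bnd n : N n -> r * (- f n) < eps.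
  by move=> /fN fn; nra.
have := nbhs0Z (lt0r_neq0 r0) N0 => rN0.
have := nbhsT x rN0; have := nbhsT x (nbhs0N rN0); apply: filterS2.
(* The same nearby point is written as [x - r *: n] and as [x + r *: m], with [n] and [m] in [N]. *)
move=> _ [_ [_ [n Nn <-] <-] <-] [_ [m Nm <-] h].
have fE : f (r *: m) = f (- (r *: n)).
  by congr f; apply: (addrI x).
rewrite /= (scalar_add f_lin) opprD addrA subrr add0r normrN ltr_norml.
have := bnd _ Nn; have := bnd _ Nm.
move: fE; rewrite !(scalar_opp f_lin) !(scalar_scale f_lin) => fE; lra.
Qed.

Section conic_hull.
Context {R : realType} {V : lmodType R} (A : set V).
Hypothesis A_conv : forall x y (a b : R),
  A x -> A y -> 0 <= a -> 0 <= b -> a + b = 1 -> A (a *: x + b *: y).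

Definition conic : set V :=
  [set x | exists2 t : R, 0 <= t & exists2 a, A a & x = t *: a].

Lemma conic_sub : A `<=` conic.
Proof. by move=> x Ax; exists 1 => //; exists x; rewrite ?scale1r. Qed.

Lemma conic0 : A !=set0 -> conic 0.
Proof. by move=> [x Ax]; exists 0 => //; exists x; rewrite ?scale0r. Qed.

Lemma conicZ (t : R) x : 0 <= t -> conic x -> conic (t *: x).
Proof.
move=> t0 [s s0 [a Aa ->]]; exists (t * s); first exact: mulr_ge0.
by exists a; rewrite ?scalerA.
Qed.

Lemma conicD x y : conic x -> conic y -> conic (x + y).
Proof.
move=> [s s0 [a Aa ->]] [t t0 [b Ab ->]].
move: s0; rewrite le_eqVlt => /orP[/eqP <-|s0].
  by rewrite scale0r add0r; exists t => //; exists b.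
have st0 : 0 < s + t by lra.
exists (s + t); first exact: ltW.
exists ((s / (s + t)) *: a + (t / (s + t)) *: b).
  apply: A_conv => //; first by rewrite divr_ge0// ltW.
    by rewrite divr_ge0// ltW.
  by rewrite -mulrDl divff// lt0r_neq0.
by rewrite scalerDr !scalerA !(mulrC (s + t)) !divfK// lt0r_neq0.
Qed.

End conic_hull.

Section separation.
Context {R : realType} {U Y : tvsType R}.
Variables (K : set Y) (k : Y).
Hypotheses (K_cone : convex_cone K) (K0 : K 0) (nK0 : ~ K° 0) (Kk : K° k).

(** The functional comes from [pos_functional] with unit [(0, k)], on the cone generated by the
    shifted set [A], by [B], which is [N] at the constant height [c *: k], and by [K]. The set [B]
    makes this cone absorbing and bounds [g] below on [N], which gives continuity. [E] itself has to
    be bounded only over the part of [N] lying opposite to its own projection. *)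
Lemma cone_separation (E : set (U * Y)) (N : set U) (yL v : Y) :
  (forall p q (a b : R),
    E p -> E q -> 0 <= a -> 0 <= b -> a + b = 1 -> E (a *: p + b *: q)) ->
  E !=set0 ->
  nbhs 0 N -> convex_set N ->
  (forall u y (r : R),
    E (u, y) -> 0 <= r -> N (- (r *: u)) -> E (- (r *: u), yL)) ->
  (forall y, E (0, y) -> ~ K° (v - y)) ->
  exists (g : U -> R) (h : Y -> R),
    [/\ scalar g /\ continuous (g : U -> R^o),
        scalar h /\ continuous (h : Y -> R^o),
        forall y, K y -> 0 <= h y, h k = 1 &
        forall u y, E (u, y) -> 0 <= g u + h (y - v)].
Proof.
move=> E_conv [[u1 y1] E1] N0 N_conv E_abs E_v.
(* The height [c *: k] is taken strictly above [yL - v], so that [B] lies above the bound given by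
   [E_abs]. *)
have [c c0 Kc] := interior_cone_abs K_cone (v - yL) Kk.
pose A := [set p : U * Y | E (p.1, p.2 + v)].
pose B := [set p : U * Y | N p.1 /\ p.2 = c *: k].
have A_conv x y (a b : R) :
    A x -> A y -> 0 <= a -> 0 <= b -> a + b = 1 -> A (a *: x + b *: y).
  move=> Ax Ay a0 b0 ab1.
  have := E_conv _ _ _ _ Ax Ay a0 b0 ab1; rewrite /A/=.
  congr E; congr pair => /=; rewrite !scalerDr addrACA; congr (_ + _).
  by rewrite -scalerDl ab1 scale1r.
have B_conv x y (a b : R) :
    B x -> B y -> 0 <= a -> 0 <= b -> a + b = 1 -> B (a *: x + b *: y).
  move=> [Nx xk] [Ny yk] a0 b0 ab1; split; first exact: convex_set_comb.
  by rewrite /= xk yk -scalerDl ab1 scale1r.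
have A0 : A !=set0 by exists (u1, y1 - v); rewrite /A/= subrK.
have B0 : B !=set0 by exists (0, c *: k); split => //=; exact: nbhs_singleton.
pose Q := [set p | exists a b y, [/\ conic A a, conic B b, K y & p = a + b + (0, y)]].
have [KZ _] := K_cone.
have AQ a : A a -> Q a.
  move=> Aa; exists a, 0, 0; split => //; [exact: conic_sub|exact: conic0|].
  by rewrite addr0 addr0.
have BQ b : B b -> Q b.
  move=> Bb; exists 0, b, 0; split => //; [exact: conic0|exact: conic_sub|].
  by rewrite add0r addr0.
have KQ y : K y -> Q (0, y).
  move=> Ky; exists 0, 0, y; split => //; [exact: conic0|exact: conic0|].
  by rewrite addr0 add0r.
have [|||||f [f_lin fQ fk]] := @pos_functional R (U * Y)%type Q (0, k).
- exact: KQ.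
- move=> _ _ [a [b [y [Aa Bb Ky ->]]]] [a' [b' [y' [Aa' Bb' Ky' ->]]]].
  exists (a + a'), (b + b'), (y + y'); split; [exact: conicD|exact: conicD| |].
    exact: cone_addr.
  rewrite addrACA (addrACA a); congr (_ + _).
  by congr pair; rewrite /= addr0.
- move=> t _ t0 [a [b [y [Aa Bb Ky ->]]]].
  exists (t *: a), (t *: b), (t *: y); split; [| |exact: KZ|].
  + by apply: conicZ => //; exact: ltW.
  + by apply: conicZ => //; exact: ltW.
  + by rewrite !scalerDr; congr (_ + _); congr pair; rewrite /= scaler0.
(* Suppose [(0, - k)] is a sum of [t] times a point of [A], [s] times a point of [B] and an element
   of [K]. In every case this contradicts [nK0] or produces a point of [E] over [0] strictly below
   [v]. *)
- move=> [_ [_ [y [[t t0 [[ua ya] Aa ->]] [s s0 [[n _] [/= Nn ->] ->]] Ky]]]].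
  move=> [] /=; rewrite oppr0 addr0 => uE yE.
  have tyE : - (t *: ya) = k + (s *: (c *: k) + y).
    by apply: oppr_inj; rewrite opprK opprD yE -[X in X - _]addrA addrK.
  have Ky' : K° (k + y) by exact: interior_cone_addr.
  move: s0; rewrite le_eqVlt => /orP[/eqP s0|s0].
    move: uE tyE; rewrite /= -s0 !scale0r !addr0 add0r => uE tyE.
    move: t0; rewrite le_eqVlt => /orP[/eqP t0|t0].
      by apply: nK0; move: tyE Ky'; rewrite -t0 scale0r oppr0 => <-.
    have ua0 : ua = 0.
      rewrite -(scale1r ua) -(mulVf (lt0r_neq0 t0)) -scalerA -uE.
      by rewrite scaler0.
    move: Aa; rewrite /A/= ua0 => /E_v; apply.
    rewrite opprD addrA addrAC subrr add0r.
    have -> : - ya = t^-1 *: (- (t *: ya)).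
      by rewrite scalerN scalerA mulVf ?lt0r_neq0// scale1r.
    by rewrite tyE; apply: interior_cone_scale; rewrite ?invr_gt0.
  (* The components in [U] cancel, so [n] is a negative multiple of [ua]. This is exactly where
     [E_abs] supplies the value [yL], and the combination with weights [t / (t + s)] and
     [s / (t + s)] lies over [0]. *)
  have nE : n = - ((t / s) *: ua).
    apply: (scalerI (lt0r_neq0 s0)).
    rewrite scalerN scalerA mulrC divfK ?lt0r_neq0//.
    by apply/eqP; rewrite -addr_eq0 addrC -uE.
  have st0 : 0 < t + s by rewrite ltr_wpDl.
  have EnL : E (n, yL).
    rewrite nE; apply: E_abs Aa _ _; first by rewrite divr_ge0// ltW.
    by rewrite -nE.
  have := E_conv _ _ (t / (t + s)) (s / (t + s)) Aa EnL.
  rewrite !divr_ge0 ?(ltW st0) ?(ltW s0)// => /(_ isT isT).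
  rewrite -mulrDl divff ?lt0r_neq0// => /(_ erefl).
  have -> : (t / (t + s)) *: (ua, ya + v) + (s / (t + s)) *: (n, yL) =
      (0, (t + s)^-1 *: (t *: (ya + v) + s *: yL)) :> (U * Y)%type.
    congr pair => /=; rewrite ![_ / _]mulrC -!scalerA -scalerDr//.
    by rewrite -uE; rewrite scaler0.
  move=> /E_v; apply.
  have -> : v - (t + s)^-1 *: (t *: (ya + v) + s *: yL) =
      (t + s)^-1 *: ((k + y) + s *: (c *: k + (v - yL))).
    have -> : k + y + s *: (c *: k + (v - yL)) = - (t *: ya) + s *: (v - yL).
      by rewrite tyE scalerDr addrA -[k + y + _]addrA (addrC y).
    apply: (scalerI (lt0r_neq0 st0)).
    rewrite scalerBr !scalerA divff ?lt0r_neq0// !scale1r.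
    rewrite scalerDl opprD addrACA -!scalerBr; congr (_ + _).
    by rewrite opprD addrCA subrr addr0 scalerN.
  apply: interior_cone_scale; rewrite ?invr_gt0//.
  apply: interior_cone_addr => //; apply: KZ => //.
  exact: interior_subset.
(* Absorption: [B] handles the component [u], since [N] absorbs it, and a multiple of [k] handles
   [y]. *)
- move=> [u y].
  have [e e0 Ne] := interior_line u N0.
  have [t t0 Kt] := interior_cone_abs K_cone y Kk.
  exists (e^-1 * c + t); exists 0, (e^-1 *: (e *: u, c *: k)), (t *: k + y).
  split; [exact: conic0| |exact: interior_subset|].
    exists e^-1; first by rewrite invr_ge0 ltW.
    exists (e *: u, c *: k) => //; split => //=.
    by move: Ne; rewrite add0r => /interior_subset.
  rewrite add0r; congr pair => /=.
    by rewrite scaler0 !addr0 scalerA mulVf ?lt0r_neq0// scale1r.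
  by rewrite scalerDl scalerA addrC -addrA.

have fE u y : f (u, y) = f (u, 0) + f (0, y).
  by rewrite -(scalar_add f_lin); congr f; congr pair; rewrite /= ?addr0 ?add0r.
have g_lin : scalar (fun u => f (u, 0)).
  by move=> a x y; rewrite -f_lin; congr f; congr pair; rewrite /= scaler0 addr0.
have h_lin : scalar (fun y => f (0, y)).
  by move=> a x y; rewrite -f_lin; congr f; congr pair; rewrite /= scaler0 addr0.
exists (fun u => f (u, 0)), (fun y => f (0, y)); split => //.
- split => //; apply: (@scalar_continuous _ _ _ N c) => // n Nn.
  have /fQ : Q (n, c *: k) by apply: BQ.
  rewrite fE (scalar_scale h_lin) fk; lra.
- split => //; apply: (@scalar_continuous _ _ _ [set y | K (y + k)] 1) => //.
    have := nbhsB (- k) Kk; rewrite addNr; apply: filterS => _ [z Kz <-].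
    by rewrite /= addrAC addNr add0r.
  by move=> n /= /KQ /fQ; rewrite (scalar_add h_lin) fk; lra.
- by move=> y Ky; apply: fQ; exact: KQ.
- move=> u y Euy; rewrite -fE; apply/fQ/AQ.
  by rewrite /A/= subrK.
Qed.

End separation.

(** * Weak infima and their equality with weak maxima *)

Section weak_extrema.
Context {R : realType} {Y : tvsType R}.
Variables (K : set Y) (k : Y).
Hypotheses (K_cone : convex_cone K) (K0 : K 0) (Kk : K° k).

Lemma bar_lt_opp (a b : \bar Y) : bar_lt K a b -> bar_lt K (- b)%E (- a)%E.
Proof.
case: a b => [a| |] [b| |] //= /cone_ltE ab; apply/cone_ltE.
by rewrite opprK addrC.
Qed.

Lemma oppeKK (a : \bar Y) : (- - a)%E = a.
Proof. by case: a => //= a; rewrite opprK. Qed.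

Lemma winfE (M : set (\bar Y)) v : winf K M v <-> wsup K (-%E @` M) (- v)%E.
Proof.
split; first by move=> [u uM <-]; rewrite oppeKK.
by move=> h; exists (- v)%E => //; rewrite oppeKK.
Qed.

Lemma wsup_neq_pinfty (M : set (\bar Y)) :
  wsup K M <> [set +oo%E] <-> exists y : Y, ~ below K M y%:E.
Proof.
split.
  apply: contra_notP => /forallNP allM; rewrite wsup_below.
  have {}allM y : below K M y%:E by apply: contrapT.
  apply/seteqP; split => [[y| |] //= [h1 _]|_ -> /=].
  - by case: h1.
  - by case: h1; apply: (@below_down _ _ _ K_cone _ _ 0%:E).
  - split; first by move=> [].
    by move=> [y| |] //= _; apply: (@below_down _ _ _ K_cone _ _ 0%:E).
move=> [y yM] h; have : wsup K M +oo%E by rewrite h.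
by rewrite wsup_below => -[_ /(_ y%:E I)].
Qed.

(** Weak duality together with attainment gives equality. If a maximal [d] of [D] were not a weak
    infimum of [M], [wsup_gap] would give a weak infimum strictly above [d]; it lies in [D], against
    maximality. *)
Lemma winf_wmax (M D : set (\bar Y)) :
  (forall v d, M v -> D d -> ~ bar_lt K v d) -> winf K M `<=` D ->
  winf K M = wmax K D.
Proof.
move=> weak strong.
have infM v : winf K M v -> forall t, bar_lt K v t ->
    exists2 u, M u & bar_lt K u t.
  move=> /winfE[_ h] t /bar_lt_opp /h[_ [u Mu <-]] /bar_lt_opp.
  by rewrite !oppeKK; exists u.
apply/seteqP; split => [v Mv|d [Dd]]; rewrite ?wsup_below.
  split; first exact: strong.
  rewrite wsup_below; split; last by move=> t tv; exists v => //; exact: strong.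
  by move=> [d Dd /(infM _ Mv)[u Mu]]; exact: weak.
move=> [dD _]; apply/winfE; rewrite wsup_below; split.
  move=> [_ [u Mu <-] /bar_lt_opp]; rewrite !oppeKK; exact: weak.
move=> t td; apply: contrapT => tM.
have [v vM vd] := wsup_gap K_cone K0 Kk td tM.
apply: dD; exists (- v)%E; first by apply: strong; apply/winfE; rewrite oppeKK.
by rewrite -(oppeKK d); exact: bar_lt_opp.
Qed.

End weak_extrema.

(** * Linear hulls, convex combinations and rank-one operators *)

Lemma linear_hull_add (R : realType) (V : tvsType R) (A : set V) x y :
  linear_hull A x -> linear_hull A y -> linear_hull A (x + y).
Proof.
move=> [m [c [a [Aa ->]]]] [n [d [b [Ab ->]]]].
exists (m + n)%N.
exists (fun i => match fintype.split i with inl j => c j | inr j => d j end).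
exists (fun i => match fintype.split i with inl j => a j | inr j => b j end).
split; first by move=> i; case: fintype.split => j.
rewrite big_split_ord /=; congr (_ + _); apply: eq_bigr => i _.
  by rewrite (unsplitK (inl i)).
by rewrite (unsplitK (inr i)).
Qed.

Lemma linear_hull_scale (R : realType) (V : tvsType R) (A : set V) (t : R) x :
  linear_hull A x -> linear_hull A (t *: x).
Proof.
move=> [m [c [a [Aa ->]]]]; exists m, (fun i => t * c i), a; split => //.
by rewrite scaler_sumr; apply: eq_bigr => i _; rewrite scalerA.
Qed.

Lemma sub_linear_hull (R : realType) (V : tvsType R) (A : set V) :
  A `<=` linear_hull A.
Proof.
move=> x Ax; exists 1%N, (fun=> 1), (fun=> x); split => //.
by rewrite big_ord1 scale1r.
Qed.

Lemma convex_nbhs0 (R : realType) (V : tvsType R) (A : set V) :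
  nbhs 0 A -> exists N : set V, [/\ nbhs 0 N, convex_set N & N `<=` A].
Proof.
have [B Bconv [Bopen Bbasis]] := @locally_convex R V.
move=> /Bbasis[N [BN N0] NA]; exists N; split => //.
  by apply: open_nbhs_nbhs; split => //; exact: Bopen.
by apply: Bconv; exact: mem_set.
Qed.

(** The offsets [q1] and [q2] are there because [Q] may lack [0]: the graph of [E] itself need not
    lie in the epigraph whose convexity is assumed. *)
Lemma cone_convex_comb (R : realType) (U V : tvsType R) (Q : set V)
    (E : U -> option V) u1 u2 e1 e2 q1 q2 (a b : R) :
  cone_convex Q E -> E u1 = Some e1 -> E u2 = Some e2 -> Q q1 -> Q q2 ->
  0 <= a -> 0 <= b -> a + b = 1 ->
  exists2 e, E (a *: u1 + b *: u2) = Some e &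
    Q (a *: (e1 + q1) + b *: (e2 + q2) - e).
Proof.
move=> Econv Eu1 Eu2 Qq1 Qq2 a0 b0 ab1.
have [||e /= He Qe] := convex_set_comb (x := (u1, e1 + q1))
  (y := (u2, e2 + q2)) Econv _ _ a0 b0 ab1.
- by exists e1 => //=; rewrite addrAC subrr add0r.
- by exists e2 => //=; rewrite addrAC subrr add0r.
- by exists e.
Qed.

Lemma cont_lin_line (R : realType) (U V : tvsType R) (phi : U -> R) (k : V) :
  scalar phi -> continuous (phi : U -> R^o) ->
  cont_lin (fun u => phi u *: k).
Proof.
move=> phi_lin phi_cont; split.
  by move=> a x y; rewrite phi_lin scalerDl scalerA.
move=> x; apply: (@continuous_comp U (R^o * V)%type V (fun s => (phi s, k))
    (fun x => x.1 *: x.2)); last exact: scale_continuous.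
apply: (@cvg_pair _ _ _ _ (nbhs (phi x : R^o)) (nbhs k)); first exact: phi_cont.
exact: cvg_cst.
Qed.

Lemma cont_lin0 (R : realType) (U V : tvsType R) : cont_lin (fun _ : U => 0 : V).
Proof.
split; first by move=> a x y; rewrite scaler0 addr0.
by move=> x; exact: cvg_cst.
Qed.

(** Letting [t] tend to [0] and to infinity. The first half removes offsets in cones that may lack
    [0]; the second gives the signs of multipliers. *)
Lemma affine_ge0 (R : realType) (a b : R) :
  (forall t : R, 0 < t -> 0 <= a + t * b) -> 0 <= a /\ 0 <= b.
Proof.
move=> h; split; rewrite leNgt; apply/negP => lt0.
  have [b0|b0] := leP b 0; first by have := h 1 ltr01; lra.
  have := h (- a / (2 * b)); rewrite divr_gt0 ?mulr_gt0 ?oppr_gt0// => /(_ isT).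
  have -> : - a / (2 * b) * b = - a / 2 by field; rewrite lt0r_neq0.
  lra.
have := h ((`|a| + 1) / - b).
rewrite divr_gt0 ?oppr_gt0 ?ltr_wpDl// => /(_ isT).
have -> : (`|a| + 1) / - b * b = - (`|a| + 1) by field; rewrite lt_eqF.
have := ler_norm a; lra.
Qed.

Section positive_on_interior.
Context {R : realType} {Y : tvsType R}.
Variables (K : set Y) (k : Y) (h : Y -> R).
Hypotheses (h_lin : scalar h) (h_pos : forall y, K y -> 0 <= h y) (hk : h k = 1).

(** Since [y - e *: k] is still in [K], [h y >= e]. *)
Lemma scalar_interior_gt0 y : K° y -> 0 < h y.
Proof.
move=> /(interior_line (- k))[e e0 /interior_subset /h_pos].
rewrite (scalar_add h_lin) (scalar_scale h_lin) (scalar_opp h_lin) hk; lra.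
Qed.

(** The finite point [r *: k] has [h]-value [r], so no value [T u - e] can be strictly above it. *)
Lemma dom_conjugate_bounded (U : tvsType R) (E : U -> option Y) (T : U -> Y)
    (r : R) : convex_cone K -> cont_lin T ->
  (forall u e, E u = Some e -> h (T u - e) <= r) -> dom_conjugate K E T.
Proof.
move=> K_cone T_lin bnd; split => //; apply/wsup_neq_pinfty => //.
exists (r *: k) => -[_ [u _ <-]]; case Eu : (E u) => [e|] //= /cone_ltE.
move=> /scalar_interior_gt0.
rewrite (scalar_sub h_lin) (scalar_scale h_lin) hk; have := bnd _ _ Eu; lra.
Qed.

End positive_on_interior.

(** * Dual values and weak duality *)

Definition conj_vals (R : realType) (U V : tvsType R) (E : U -> option V)
    (T : U -> V) : set (\bar V) :=
  [set ((T u)%:E - top_ext (E u))%E | u in setT].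

Section linear_maps.
Context {R : realType} {U V : lmodType R} (T : U -> V).
Hypothesis T_lin : linear T.

Lemma linear_map_add u v : T (u + v) = T u + T v.
Proof. by have := T_lin 1 u v; rewrite !scale1r. Qed.

Lemma linear_map0 : T 0 = 0.
Proof. by apply: (addrI (T 0)); rewrite -linear_map_add !addr0. Qed.

Lemma linear_map_scale t u : T (t *: u) = t *: T u.
Proof. by have := T_lin t u 0; rewrite linear_map0 !addr0. Qed.

Lemma linear_map_opp u : T (- u) = - T u.
Proof. by rewrite -scaleN1r linear_map_scale scaleN1r. Qed.

Lemma linear_map_sub u v : T (u - v) = T u - T v.
Proof. by rewrite linear_map_add linear_map_opp. Qed.

End linear_maps.

(** Positivity of [T] keeps all values in [- K]. As [0] may be missing from [S], the value [0] is
    only approached, along [- (e *: s0)] with [e] small. *)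
Lemma conjugate_indicator (R : realType) (Z Y : tvsType R) (K : set Y) (k : Y)
    (S : set Z) (T : Z -> Y) :
  convex_cone K -> K° k -> convex_cone S -> S !=set0 -> lin_pos S K T ->
  conjugate K (indicator (opp_set S)) T = wsup K [set 0%:E].
Proof.
move=> K_cone Kk [SZ _] [s0 Ss0] [[T_lin _] TS]; apply: wsup_ext.
apply/seteqP; split => t.
  move=> [_ [z _ <-]]; rewrite /indicator; case: ifPn => [/set_mem [s Ss <-]|_].
    move=> tT; exists 0%:E => //; move: tT; case: t => [t| |] //=.
    rewrite subr0 => /cone_lt_le_trans; apply => //.
    rewrite sub0r -(linear_map_opp T_lin) opprK; apply: TS.
    by exists s.
  by case: t.
move=> [_ ->]; case: t => [t| |] //=; last first.
  move=> _; exists (T (- s0) - 0)%:E => //; exists (- s0) => //.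
  by rewrite /indicator mem_set//; exists s0.
move=> /cone_ltE /(interior_line (T (- s0)))[e e0 he].
exists (T (- (e *: s0)) - 0)%:E.
  exists (- (e *: s0)) => //.
  by rewrite /indicator mem_set//; exists (e *: s0) => //; exact: SZ.
apply/cone_ltE; rewrite subr0 -scalerN (linear_map_scale T_lin) addrC.
by move: he; rewrite sub0r.
Qed.

Section problem.
Context {R : realType} {X Y Z W : tvsType R}.
Variables (K : set Y) (k : Y).
Hypothesis K_cone : convex_cone K.
Hypotheses (K0 : K 0) (nK0 : ~ K° 0) (Kk : K° k).
Variables (P : set W) (S : set Z).
Hypotheses (S_cone : convex_cone S) (S_neq0 : S !=set0).
Variables (F : X -> option Y) (kappa : W -> option Y).
Variables (H : X -> option W) (G : X -> option Z) (C : set X).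

Section dual_terms.
Variables (L L1 L2 : X -> Y) (T1 : W -> Y) (T2 : Z -> Y).

(** The term of the cone [S] is left out, so that one set serves both duals. *)
Definition dual_vals : set (\bar Y) :=
  [set (a + b)%E | a in
  [set (a + b)%E | a in
  [set (a + b)%E | a in conj_vals F L1
                 & b in conj_vals (lin_comp H G T1 T2) (L \- L1 \- L2)]
                 & b in conj_vals (indicator C) L2]
                 & b in conj_vals kappa T1].

Lemma dual_wsum : wsum K (wsum K (wsum K
    (conjugate K F L1) (conjugate K (lin_comp H G T1 T2) (L \- L1 \- L2)))
    (conjugate K (indicator C) L2)) (conjugate K kappa T1)
  = wsup K dual_vals.
Proof. by rewrite /conjugate !(wsum_wsup K_cone K0 Kk). Qed.

Lemma dual_wsum_indicator : lin_pos S K T2 ->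
  wsum K (wsup K dual_vals) (conjugate K (indicator (opp_set S)) T2)
  = wsup K dual_vals.
Proof.
move=> T2pos; rewrite (conjugate_indicator K_cone Kk S_cone S_neq0 T2pos).
rewrite (wsum_wsup K_cone K0 Kk); congr wsup.
apply/seteqP; split => [_ [a aV [_ -> <-]]|a aV].
  by rewrite (_ : (a + 0%:E)%E = a)//; case: a {aV} => //= a; congr (_%:E); rewrite addr0.
by exists a => //; exists 0%:E => //; case: a {aV} => //= a; congr (_%:E); rewrite addr0.
Qed.

Lemma dual_vals_intro u f x w z c w' y :
  F u = Some f -> H x = Some w -> G x = Some z -> C c -> kappa w' = Some y ->
  dual_vals ((L1 u - f) + ((L x - L1 x - L2 x) - (T1 w + T2 z)) + L2 c
             + (T1 w' - y))%:E.
Proof.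
move=> Fu Hx Gx Cc kw.
exists ((L1 u - f) + ((L x - L1 x - L2 x) - (T1 w + T2 z)) + L2 c)%:E; last first.
  by exists (T1 w' - y)%:E => //; exists w' => //; rewrite kw.
exists ((L1 u - f) + ((L x - L1 x - L2 x) - (T1 w + T2 z)))%:E; last first.
  exists (L2 c)%:E => //; exists c => //.
  by rewrite /indicator mem_set//=; congr (_%:E); rewrite subr0.
exists (L1 u - f)%:E; first by exists u => //; rewrite Fu.
exists ((L x - L1 x - L2 x) - (T1 w + T2 z))%:E => //.
by exists x => //; rewrite /lin_comp Hx Gx.
Qed.

Lemma dual_vals_elim t v : dual_vals v -> bar_lt K t v ->
  exists u f x w z, [/\ F u = Some f, H x = Some w, G x = Some z &
  exists c w' y, [/\ C c, kappa w' = Some y &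
   v = ((L1 u - f) + ((L x - L1 x - L2 x) - (T1 w + T2 z)) + L2 c
             + (T1 w' - y))%:E]].
Proof.
move=> [_ [_ [_ [u _ <-] [_ [x _ <-] <-]] [_ [c _ <-] <-]] [_ [w' _ <-] <-]].
rewrite /lin_comp /indicator; case Fu: (F u) => [f|]; last by case: t.
case Hx: (H x) => [w|]; last by case: t.
case Gx: (G x) => [z|]; last by case: t.
case: ifPn => [/set_mem Cc|]; last by case: t.
case kw: (kappa w') => [y|]; last by case: t.
move=> _; exists u, f, x, w, z; split => //; exists c, w', y; split => //.
by congr (_%:E) => /=; rewrite subr0.
Qed.

End dual_terms.

Definition primal_vals (L : X -> Y) : set (\bar Y) :=
  [set top_ext (top_add (top_add (F x) (kappa_comp kappa H x)) (Some (- L x)))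
         | x in feasible S C G].

Lemma primal_vals_elim L v (P0 : v <> +oo%E) : primal_vals L v ->
  exists x f w z y, [/\ C x, F x = Some f, H x = Some w, G x = Some z &
    [/\ S (- z), kappa w = Some y & v = (f + y - L x)%:E]].
Proof.
move=> [x [Cx /=]]; case Gx: (G x) => [z|] //= [s Ss sz] vE.
move: vE P0; rewrite /kappa_comp; case Fx: (F x) => [f|] /= <- //.
case Hx: (H x) => [w|] //=; case kw: (kappa w) => [y|] //= _.
by exists x, f, w, z, y; split => //; split => //; rewrite -sz opprK.
Qed.

(** When the independent arguments of the conjugates are all taken from one point [x], with [w] in
    the role of [H x], the terms in [L1], [L2] and [T1] cancel. *)
Lemma dual_diag (L L1 L2 : X -> Y) (T1 : W -> Y) (T2 : Z -> Y) x f w z y :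
  (L1 x - f) + ((L x - L1 x - L2 x) - (T1 w + T2 z)) + L2 x + (T1 w - y)
  = - (f + y - L x) - T2 z.
Proof.
rewrite !opprD opprK !addrA [LHS](ACl (1*4*5*8*6*9*2*10*3*7))/=.
by rewrite subrr add0r addNr add0r addNr add0r.
Qed.

(** The indicator term, taken at the same [z], cancels the remaining [- T2 z]; thus minus the primal
    value is itself one of the sums whose weak supremum is the dual value. *)
Lemma weak_duality L v d : primal_vals L v -> dual K S C F kappa H G L d ->
  ~ bar_lt K v d.
Proof.
move=> Pv [L1 L1l [L2 L2l [T1 T1d [T2 T2d [e eE <-]]]]] vd.
have [//|x [f [w [z [y [Cx Fx Hx Gx [Sz kw vE]]]]]]] := primal_vals_elim _ Pv.
  by move=> vE; move: vd; rewrite vE; case: (- e)%E.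
move: eE; rewrite dual_wsum (wsum_wsup K_cone K0 Kk) => -[+ _].
move=> /(_ (- (f + y - L x))%:E); apply; last first.
  by move: vd => /bar_lt_opp; rewrite oppeKK vE.
exists (- (f + y - L x) - T2 z)%:E.
  by rewrite -(dual_diag L L1 L2 T1 T2 x f w z y); exact: dual_vals_intro.
exists (T2 z - 0)%:E.
  by exists z => //; rewrite /indicator mem_set//; exists (- z); rewrite ?opprK.
by congr (_%:E); rewrite subr0 subrK.
Qed.

(** On the diagonal the sum exceeds minus the primal value by [T2 (- z)], which is in [K]. *)
Lemma below_primal L L1 L2 T1 T2 : lin_pos S K T2 ->
  below K (-%E @` primal_vals L) `<=` below K (dual_vals L L1 L2 T1 T2).
Proof.
move=> [[T2lin _] T2S] t [_ [v Pv <-] tv].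
have [//|x [f [w [z [y [Cx Fx Hx Gx [Sz kw vE]]]]]]] := primal_vals_elim _ Pv.
  by move=> vE; move: tv; rewrite vE; case: t.
exists (- (f + y - L x) - T2 z)%:E.
  by rewrite -(dual_diag L L1 L2 T1 T2 x f w z y); exact: dual_vals_intro.
move: tv; rewrite vE; case: t => [t| |] //= /cone_lt_le_trans; apply => //.
rewrite addrAC subrr add0r.
rewrite -(linear_map_opp T2lin).
by apply: T2S; exists (- z).
Qed.

(** A positive [T2] is weakly positive, as an element of [K] whose opposite is interior would make
    [0] interior; and its indicator term is neutral for [wsum]. *)
Lemma dual_pos_sub L : dual_pos K P S C F kappa H G L `<=` dual K S C F kappa H G L.
Proof.
move=> d [L1 L1l [L2 L2l [T1 [T1d T1p] [T2 T2p [e eE <-]]]]].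
exists L1 => //; exists L2 => //; exists T1 => //; exists T2.
  split; first by case: T2p.
  apply/seteqP; split => // _ [[z Sz <-] [y Ky yE]].
  apply: nK0; rewrite -(subrr (- T2 z)) opprK -{1}yE opprK.
  apply: interior_cone_addr => //; case: T2p => _; apply.
  by exists z.
by exists e => //; rewrite dual_wsum dual_wsum_indicator// -dual_wsum.
Qed.

End problem.

(** * Multipliers and strong duality *)

Lemma eq_quadruple (A B C D : Type) (p q : A * B * C * D) :
  p.1.1.1 = q.1.1.1 -> p.1.1.2 = q.1.1.2 -> p.1.2 = q.1.2 -> p.2 = q.2 -> p = q.
Proof. by case: p q => [[[? ?] ?] ?] [[[? ?] ?] ?] /= -> -> -> ->. Qed.

Lemma continuous_pair (A B C : topologicalType) (f : A -> B) (g : A -> C) :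
  continuous f -> continuous g -> continuous (fun x => (f x, g x)).
Proof.
move=> f_cont g_cont x; apply: (@cvg_pair _ _ _ _ (nbhs (f x)) (nbhs (g x))).
  exact: f_cont.
exact: g_cont.
Qed.

Section multipliers.
Context {R : realType} {X Y Z W : tvsType R}.
Variables (K : set Y) (k : Y).
Hypothesis K_cone : convex_cone K.
Hypotheses (K0 : K 0) (nK0 : ~ K° 0) (Kk : K° k).
Variables (P : set W) (S : set Z).
Hypotheses (P_cone : convex_cone P) (P_neq0 : P !=set0).
Hypotheses (S_cone : convex_cone S) (S_neq0 : S !=set0).
Variables (F : X -> option Y) (kappa : W -> option Y).
Variables (H : X -> option W) (G : X -> option Z) (C : set X).
Hypotheses (F_convex : cone_convex K F) (H_convex : cone_convex P H).
Hypotheses (G_convex : cone_convex S G) (kappa_convex : cone_convex K kappa).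
Hypotheses (kappa_mono : cone_nondecreasing P K kappa).
Hypothesis C_convex : convex_set C.

Lemma nondecreasing_sub w p y : kappa w = Some y -> P p ->
  exists2 y', kappa (w - p) = Some y' & K (y - y').
Proof.
move=> kw Pp; have : cone_le P (w - p) w by apply/cone_leE; rewrite subKr.
move=> /kappa_mono; rewrite kw; case: (kappa (w - p)) => //= y' /cone_leE yy'.
by exists y'.
Qed.

Lemma cone_comb a b x y : 0 <= a -> 0 <= b -> K x -> K y -> K (a *: x + b *: y).
Proof.
have KZ0 (t : R) z : 0 <= t -> K z -> K (t *: z).
  rewrite le_eqVlt => /orP[/eqP <-|t0]; first by rewrite scale0r.
  by case: K_cone => KZ _; exact: KZ.
by move=> a0 b0 Kx Ky; apply: cone_addr => //; exact: KZ0.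
Qed.

(** A functional [h] scalarizes some [T] of the domain, and [h (T w) *: k] is the new operator. Its
    sign on [P] comes from monotonicity: [kappa] stays bounded above along [w0 - t *: p], which
    would fail to dominate [h \o T] for large [t] if [h (T p) < 0]. *)
Lemma pos_dom_conjugate : proper_map kappa ->
  dom_conjugate K kappa !=set0 -> (dom_conjugate K kappa `&` lin_pos P K) !=set0.
Proof.
move=> [w0]; rewrite /dom/=; case kw0 : (kappa w0) => [y0|] // _.
move=> [T [[T_lin T_cont] /(wsup_neq_pinfty K_cone)[v vM]]].
have Tv w y : kappa w = Some y -> ~ K° (T w - y - v).
  move=> kw KT; apply: vM; exists (T w - y)%:E; last exact/cone_ltE.
  by exists w => //; rewrite kw.
(* All of [E] lies over the zero perturbation, so the separation takes place in [Y] alone and any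
   neighbourhood, here [setT], will do. *)
pose E := [set p : W * Y | p.1 = 0 /\
  exists w y, kappa w = Some y /\ K (p.2 - (y - T w))].
have [||||||g [h [[g_lin _] [h_lin h_cont] h_pos hk gE]]] :=
  @cone_separation R W Y K k K_cone K0 nK0 Kk E setT (y0 - T w0) (- v).
- move=> [u1 y1] [u2 y2] a b [/= -> [w1 [e1 [kw1 Ky1]]]].
  move=> [/= -> [w2 [e2 [kw2 Ky2]]]] a0 b0 ab1.
  split; first by rewrite /= !scaler0 addr0.
  have [e ew Ke] := cone_convex_comb kappa_convex kw1 kw2 K0 K0 a0 b0 ab1.
  exists (a *: w1 + b *: w2), e; split => //=.
  have := cone_addr K_cone (cone_comb a0 b0 Ky1 Ky2) Ke; congr K.
  rewrite !addr0 T_lin (linear_map_scale T_lin) !scalerBr !opprD !opprK !addrA.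
  by rewrite [LHS](ACl (2*7*5*8*1*4*9*3*6))/= !(addNr, add0r).
- by exists (0, y0 - T w0); split => //; exists w0, y0; rewrite subrr.
- exact: filterT.
- by move=> x y l _ _; exact: mem_set.
- move=> u y r [/= -> _] _ _; split; first by rewrite /= scaler0 oppr0.
  by exists w0, y0; rewrite subrr.
- move=> y [_ [w [e [kw /= Ky]]]] Kv; apply: (Tv _ _ kw).
  have := interior_cone_addr K_cone Kv Ky.
  by congr (K° _); rewrite opprB addrA subrK addrC.
have hE w y : kappa w = Some y -> 0 <= h y - h (T w) + h v.
  move=> kw; have : E (0, y - T w) by split => //; exists w, y; rewrite subrr.
  move=> /gE; rewrite opprK (scalar_add h_lin) (scalar_sub h_lin).
  by rewrite (scalar0 g_lin) add0r.
exists (fun w => h (T w) *: k).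
have hT_lin : scalar (fun w => h (T w)).
  by move=> a x y; rewrite T_lin h_lin.
have hT_cont : continuous ((fun w => h (T w)) : W -> R^o).
  by move=> x; apply: continuous_comp; [exact: T_cont|exact: h_cont].
split.
  apply: (dom_conjugate_bounded h_lin h_pos hk (r := h v)) => //.
    exact: cont_lin_line.
  move=> w y kw; rewrite (scalar_sub h_lin) (scalar_scale h_lin) hk mulr1.
  by have := hE _ _ kw; lra.
split; first exact: cont_lin_line.
move=> _ [p Pp <-].
have hTp : 0 <= h (T p).
  have [|_ //] := @affine_ge0 R (h y0 - h (T w0) + h v) (h (T p)).
  move=> t t0; have [PZ _] := P_cone.
  have [y' kw' yy'] := nondecreasing_sub kw0 (PZ _ _ t0 Pp).
  have := hE _ _ kw'; have := h_pos _ yy'.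
  rewrite (linear_map_sub T_lin) (linear_map_scale T_lin) !(scalar_sub h_lin).
  rewrite (scalar_scale h_lin); lra.
move: hTp; rewrite le_eqVlt => /orP[/eqP <-|hTp]; first by rewrite scale0r.
by case: K_cone => KZ _; apply: KZ => //; exact: interior_subset.
Qed.

Section lagrange.
Variables (L : X -> Y) (v : Y).
Hypothesis L_lin : linear L.
Hypothesis reg : regularity K S C F kappa H G L.

(* Perturbing the argument of [kappa] by an element of [P] makes this set convex
   although [0] need not belong to [P]. *)
Definition perturbed : set (X * X * W * Z * Y) :=
  [set q | exists x f w z p y,
    [/\ F (x + q.1.1.1.1) = Some f, C (x + q.1.1.1.2), H x = Some w & G x = Some z] /\
    [/\ P p, kappa (w + q.1.1.2 + p) = Some y, S (- (z + q.1.2)) &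
        K (q.2 - (f + y - L x))]].

Lemma perturbed_convex p q (a b : R) : perturbed p -> perturbed q ->
  0 <= a -> 0 <= b -> a + b = 1 -> perturbed (a *: p + b *: q).
Proof.
case: p q => [[[[p1 p2] p3] p4] p5] [[[[q1 q2] q3] q4] q5].
move=> [x1 [f1 [w1 [z1 [d1 [y1 /= [[F1 C1 H1 G1] [P1 k1 S1 K1]]]]]]]].
move=> [x2 [f2 [w2 [z2 [d2 [y2 /= [[F2 C2 H2 G2] [P2 k2 S2 K2]]]]]]]].
move=> a0 b0 ab1.
have [f Ff Kf] := cone_convex_comb F_convex F1 F2 K0 K0 a0 b0 ab1.
have [w Hw Pw] := cone_convex_comb H_convex H1 H2 P1 P2 a0 b0 ab1.
have [z Gz Sz] := cone_convex_comb G_convex G1 G2 S1 S2 a0 b0 ab1.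
have [y ky Ky] := cone_convex_comb kappa_convex k1 k2 K0 K0 a0 b0 ab1.
have mid (V : lmodType R) (u1 u2 r1 r2 : V) :
    a *: u1 + b *: u2 + (a *: r1 + b *: r2) = a *: (u1 + r1) + b *: (u2 + r2).
  by rewrite !scalerDr addrACA.
(* The new element of [P] also absorbs the convexity defect of [H]. *)
exists (a *: x1 + b *: x2), f, w, z, (a *: (w1 + d1) + b *: (w2 + d2) - w), y.
split; split => //=.
- by rewrite mid.
- by rewrite mid; exact: convex_set_comb.
- rewrite -ky; congr kappa.
  rewrite addrC addrA subrK mid.
  by rewrite -!addrA (addrC d1) (addrC d2).
- move: Sz; congr S.
  by rewrite !opprD !addrA !subrr !sub0r !scalerN [LHS](ACl (3*1*2))/=.
- have := cone_addr K_cone (cone_comb a0 b0 K1 K2) (cone_addr K_cone Kf Ky).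
  congr K; rewrite !addr0 L_lin (linear_map_scale L_lin).
  rewrite !(scalerDr, scalerN, opprD, opprK) !addrA.
  rewrite [LHS](ACl (2*9*3*12*6*10*7*13*1*5*11*14*4*8))/=.
  by rewrite !(addNr, add0r).
Qed.

Lemma lagrange_multipliers x0 f0 w0 z0 y0 :
  F x0 = Some f0 -> C x0 -> H x0 = Some w0 -> G x0 = Some z0 ->
  S (- z0) -> kappa w0 = Some y0 ->
  (forall x f w z y, F x = Some f -> C x -> H x = Some w -> G x = Some z ->
     S (- z) -> kappa w = Some y -> ~ K° (v - (f + y - L x))) ->
  exists L1 L2 T1 T2 (h : Y -> R),
    [/\ [/\ cont_lin L1, cont_lin L2, lin_pos P K T1 & lin_pos S K T2],
        scalar h, forall y, K y -> 0 <= h y, h k = 1 &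
        forall u f x w z c w' y, F u = Some f -> H x = Some w ->
          G x = Some z -> C c -> kappa w' = Some y ->
          h ((L1 u - f) + ((L x - L1 x - L2 x) - (T1 w + T2 z)) + L2 c
             + (T1 w' - y)) <= - h v].
Proof.
move=> Fx0 Cx0 Hx0 Gx0 Sz0 kw0 optimal.
have [yL [N [N0 hN]]] := reg.
have [N' [N'0 N'conv N'N]] : exists N' : set (X * X * W * Z),
    [/\ nbhs (0 : (X * X * W * Z)%type) N', convex_set N' & N' `<=` N°].
  by apply: convex_nbhs0; exact: nbhs_interior.
have [PZ _] := P_cone; have [SZ _] := S_cone.
(* Lowering [w0] by [p] stays in [dom kappa] by monotonicity, so shifts along [P] are directions of
   the hull. *)
have genP p : P p -> Z03 S C F kappa H G (0, 0, p, 0).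
  move=> Pp; apply: sub_linear_hull.
  have [y1 k1 _] := nondecreasing_sub kw0 Pp.
  exists (x0, x0, w0, z0); first by exists x0, w0, z0.
  exists (x0, x0, w0 - p, z0).
    split => /=; last by exists (- z0); rewrite ?opprK.
    by split => /=; [split => //=; rewrite /dom/= Fx0|rewrite /dom/= k1].
  by apply: eq_quadruple => /=; rewrite ?subrr ?subKr.
have EZ q y : perturbed (q, y) -> Z03 S C F kappa H G (- q).
  case: q => [[[q1 q2] q3] q4].
  move=> [x [f [w [z [p [y1 /= [[F1 C1 H1 G1] [P1 k1 S1 K1]]]]]]]].
  have -> : - (q1, q2, q3, q4) = ((x, x, w, z) - (x + q1, x + q2, w + q3 + p, z + q4))
      + (0, 0, p, 0) :> (X * X * W * Z)%type.
    apply: eq_quadruple => /=.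
    - by rewrite addr0 opprD addrA subrr sub0r.
    - by rewrite addr0 opprD addrA subrr sub0r.
    - by rewrite !opprD !addrA subrr sub0r subrK.
    - by rewrite addr0 opprD addrA subrr sub0r.
  apply: linear_hull_add; last exact: genP.
  apply: sub_linear_hull; exists (x, x, w, z); first by exists x, w, z.
  exists (x + q1, x + q2, w + q3 + p, z + q4) => //.
  split => /=; last by exists (- (z + q4)); rewrite ?opprK.
  by split => /=; [split => //=; rewrite /dom/= F1|rewrite /dom/= k1].
have [p0 Pp0] := P_neq0.
(* The regularity condition is applied at [n] shifted by [e *: p0] in the third component; this
   shift is the element of [P] that [perturbed] asks for. Room for it is the reason for taking [N']
   inside the interior of [N]. *)
have NE n : N' n -> Z03 S C F kappa H G n -> perturbed (n, yL).
  move=> /N'N /(interior_line (0, 0, p0, 0))[e e0 /interior_subset Ne] Zn.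
  have Zne : Z03 S C F kappa H G (n + e *: (0, 0, p0, 0)).
    by apply: linear_hull_add => //; apply/linear_hull_scale/genP.
  case: n Ne Zne {Zn} => [[[n1 n2] n3] n4] Ne Zne.
  have [] := hN n1 n2 (n3 + e *: p0) n4.
    suff -> : (n1, n2, n3 + e *: p0, n4) =
        (n1, n2, n3, n4) + e *: (0, 0, p0, 0) :> (X * X * W * Z)%type by [].
    by apply: eq_quadruple => /=;
      rewrite ?scaler0 ?addr0.
  move=> x []; case Hx: (H x) => [w|] /=; last by case: (F _).
  case Gx: (G x) => [z|] //= Cx [s Ss sE].
  case Fx: (F (x + n1)) => [f|] //=.
  case kx: (kappa (w + (n3 + e *: p0))) => [y|] //= /cone_leE Ky.
  exists x, f, w, z, (e *: p0), y; split; split => //=.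
  - exact: PZ.
  - by rewrite -addrA.
  - by rewrite -sE opprK.
have Z0 : Z03 S C F kappa H G 0.
  by have := linear_hull_scale 0 (genP _ Pp0); rewrite scale0r.
have [||||||g [h [[g_lin g_cont] [h_lin h_cont] h_pos hk gE]]] :=
  @cone_separation R (X * X * W * Z)%type Y K k K_cone K0 nK0 Kk perturbed N' yL v.
- by move=> p q a b Ep Eq a0 b0 ab1; exact: perturbed_convex.
- by exists (0, yL); apply: NE => //; exact: nbhs_singleton.
- exact: N'0.
- exact: N'conv.
- move=> u y r Euy r0 Nu; apply: NE => //.
  by rewrite -scalerN; apply/linear_hull_scale/EZ/Euy.
(* Over the zero perturbation, dropping [p] can only lower the value of [kappa], so optimality of
   [v] applies. *)
- move=> y' [x [f [w [z [p [y /= [[F1 C1 H1 G1] [P1 k1 S1 K1]]]]]]]] Kv.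
  move: F1 C1 S1 k1; rewrite !addr0 => F1 C1 S1 k1.
  have [y2 k2 K2] := nondecreasing_sub k1 P1; rewrite addrK in k2.
  apply: (optimal _ _ _ _ _ F1 C1 H1 G1 S1 k2).
  have := interior_cone_addr K_cone Kv (cone_addr K_cone K1 K2).
  congr (K° _); rewrite !opprD !opprK !addrA.
  by rewrite [LHS](ACl (2*3*5*7*1*4*8*6))/= !(addNr, add0r).
pose ga x := g (x, 0, 0, 0); pose gb x := g (0, x, 0, 0).
pose gc w := g (0, 0, w, 0); pose gd z := g (0, 0, 0, z).
have gsum x1 x2 w z : g (x1, x2, w, z) = ga x1 + gb x2 + gc w + gd z.
  rewrite -!(scalar_add g_lin); congr g.
  by apply: eq_quadruple => /=;
    rewrite ?addr0 ?add0r.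
have ga_lin : scalar ga.
  by move=> a x y; rewrite -g_lin; congr g;
    apply: eq_quadruple => /=; rewrite ?scaler0 ?addr0.
have gb_lin : scalar gb.
  by move=> a x y; rewrite -g_lin; congr g;
    apply: eq_quadruple => /=; rewrite ?scaler0 ?addr0.
have gc_lin : scalar gc.
  by move=> a x y; rewrite -g_lin; congr g;
    apply: eq_quadruple => /=; rewrite ?scaler0 ?addr0.
have gd_lin : scalar gd.
  by move=> a x y; rewrite -g_lin; congr g;
    apply: eq_quadruple => /=; rewrite ?scaler0 ?addr0.
have g_comp (V : tvsType R) (e : V -> (X * X * W * Z)%type) :
    continuous e -> continuous ((g \o e) : V -> R^o).
  by move=> e_cont x; apply: continuous_comp; [exact: e_cont|exact: g_cont].
have cst (V V' : tvsType R) (a : V') : continuous (fun _ : V => a).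
  by move=> x; exact: cvg_cst.
have idc (V : tvsType R) : continuous (fun x : V => x) by move=> x; exact: cvg_id.
have quad (V : tvsType R) (e1 e2 : V -> X) (e3 : V -> W) (e4 : V -> Z)
    (c1 : continuous e1) (c2 : continuous e2) (c3 : continuous e3)
    (c4 : continuous e4) : continuous (fun x => (e1 x, e2 x, e3 x, e4 x)).
  exact: continuous_pair (continuous_pair (continuous_pair c1 c2) c3) c4.
have ga_cont : continuous (ga : X -> R^o).
  exact: (g_comp X _ (quad X _ _ _ _ (idc X) (cst X X 0) (cst X W 0) (cst X Z 0))).
have gb_cont : continuous (gb : X -> R^o).
  exact: (g_comp X _ (quad X _ _ _ _ (cst X X 0) (idc X) (cst X W 0) (cst X Z 0))).
have gc_cont : continuous (gc : W -> R^o).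
  exact: (g_comp W _ (quad W _ _ _ _ (cst W X 0) (cst W X 0) (idc W) (cst W Z 0))).
have gd_cont : continuous (gd : Z -> R^o).
  exact: (g_comp Z _ (quad Z _ _ _ _ (cst Z X 0) (cst Z X 0) (cst Z W 0) (idc Z))).
pose val u f x w z c w' y := ga u - ga x + (gb c - gb x) + (gc w' - gc w)
  - gd z + h f + h y - h (L x) - h v.
(* The perturbation [(u - x, c - x, w' - w - p, - s - z)] decouples the arguments of [F], [C] and
   [kappa] from [x], as the conjugates require. *)
have ineq u f x w z c w' y p s : F u = Some f -> H x = Some w ->
    G x = Some z -> C c -> kappa w' = Some y -> P p -> S s ->
    0 <= val u f x w z c w' y - gc p - gd s.
  move=> Fu Hx Gx Cc kw' Pp Ss.
  have /gE : perturbed (u - x, c - x, w' - w - p, - s - z, f + y - L x).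
    exists x, f, w, z, p, y; split; split => //=; rewrite ?subrKC ?subrr//.
    - by rewrite addrA subrK subrKC.
    - by rewrite opprK.
  rewrite gsum (scalar_sub ga_lin) (scalar_sub gb_lin) !(scalar_sub gc_lin).
  rewrite (scalar_sub gd_lin) (scalar_opp gd_lin) !(scalar_sub h_lin).
  by rewrite (scalar_add h_lin) /val; lra.
have [s0 Ss0] := S_neq0.
have ineq_base p s := ineq _ _ _ _ _ _ _ _ p s Fx0 Hx0 Gx0 Cx0 kw0.
have neg_P p : P p -> 0 <= - gc p.
  move=> Pp; have [|_ //] := @affine_ge0 R
    (val x0 f0 x0 w0 z0 x0 w0 y0 - gd s0) (- gc p).
  move=> t t0; have := ineq_base _ _ (PZ _ _ t0 Pp) Ss0.
  by rewrite (scalar_scale gc_lin); lra.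
have neg_S s : S s -> 0 <= - gd s.
  move=> Ss; have [|_ //] := @affine_ge0 R
    (val x0 f0 x0 w0 z0 x0 w0 y0 - gc p0) (- gd s).
  move=> t t0; have := ineq_base _ _ Pp0 (SZ _ _ t0 Ss).
  by rewrite (scalar_scale gd_lin); lra.
have ineq0 u f x w z c w' y : F u = Some f -> H x = Some w ->
    G x = Some z -> C c -> kappa w' = Some y ->
    0 <= val u f x w z c w' y.
  move=> Fu Hx Gx Cc kw'; have [|//] := @affine_ge0 R
    (val u f x w z c w' y) (- gc p0 - gd s0).
  move=> t t0.
  have := ineq _ _ _ _ _ _ _ _ _ _ Fu Hx Gx Cc kw' (PZ _ _ t0 Pp0) (SZ _ _ t0 Ss0).
  by rewrite (scalar_scale gc_lin) (scalar_scale gd_lin); lra.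
have NL (V : tvsType R) (phi : V -> R) : scalar phi ->
    continuous (phi : V -> R^o) -> cont_lin (fun u => (- phi u) *: k).
  move=> phi_lin phi_cont; apply: cont_lin_line.
    by move=> a x y; rewrite phi_lin opprD mulrN.
  by move=> x; apply: continuousN; exact: phi_cont.
have K_line (t : R) : 0 <= t -> K (t *: k).
  rewrite le_eqVlt => /orP[/eqP <-|t0]; first by rewrite scale0r.
  by case: K_cone => KZ _; apply: KZ => //; exact: interior_subset.
(* Since [h k = 1], applying [h] to these operators gives back the components of [- g]. *)
exists (fun x => (- ga x) *: k), (fun x => (- gb x) *: k),
  (fun x => (- gc x) *: k), (fun x => (- gd x) *: k), h; split => //.
  split; [exact: NL|exact: NL| |].
    by split; [exact: NL|move=> _ [p Pp <-]; exact/K_line/neg_P].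
  by split; [exact: NL|move=> _ [s Ss <-]; exact/K_line/neg_S].
move=> u f x w z c w' y Fu Hx Gx Cc kw'.
have := ineq0 _ _ _ _ _ _ _ _ Fu Hx Gx Cc kw'; rewrite /val.
rewrite !(scalar_add h_lin) !(scalar_opp h_lin) !(scalar_add h_lin).
rewrite !(scalar_scale h_lin) hk; lra.
Qed.

End lagrange.

Hypothesis kappa_proper : proper_map kappa.
Hypothesis kappa_dual : dom_conjugate K kappa !=set0.
Hypothesis base : feasible S C G `&` dom F
  `&` [set x | top_mem (dom kappa) (H x)] !=set0.

Lemma strong_duality (L : X -> Y) : cont_lin L ->
  regularity K S C F kappa H G L ->
  winf K (primal_vals S F kappa H G C L) `<=` dual_pos K P S C F kappa H G L.
Proof.
move=> [L_lin _] reg v vM.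
have vsup := (winfE K _ v).1 vM.
have [x0 [[[Cx0 /= Gx0] Fx0] Hx0]] := base.
move: Gx0 Fx0 Hx0; rewrite /dom/=.
case Gx0: (G x0) => [z0|] //= [s0 Ss0 s0z]; case Fx0: (F x0) => [f0|] // _.
case Hx0: (H x0) => [w0|] //=; case kw0: (kappa w0) => [y0|] // _.
have Sz0 : S (- z0) by rewrite -s0z opprK.
have base_val : primal_vals S F kappa H G C L (f0 + y0 - L x0)%:E.
  exists x0; first by split => //=; rewrite Gx0; exists s0.
  by rewrite /kappa_comp Fx0 Hx0 /= kw0.
case: v vM vsup => [v| |] vM vsup; last first.
(* Primal value [-oo]: every point below [+oo] is below the negated primal values, hence below the
   dual sums, whatever admissible multipliers are chosen. *)
- have [T1 [T1d T1p]] := pos_dom_conjugate kappa_proper kappa_dual.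
  exists (fun=> 0); first exact: cont_lin0.
  exists (fun=> 0); first exact: cont_lin0.
  exists T1 => //; exists (fun=> 0).
    by split; [exact: cont_lin0|move=> _ [z _ <-]].
  exists +oo%E => //; rewrite (dual_wsum K_cone K0 Kk) wsup_below.
  split; first by move=> [].
  move=> t too; apply: (below_primal K_cone).
    by split; [exact: cont_lin0|move=> _ [z _ <-]].
  by move: vsup; rewrite wsup_below => -[_]; apply.
- move: vsup; rewrite wsup_below => -[h _]; case: h.
  by exists (- (f0 + y0 - L x0)%:E)%E => //; exists (f0 + y0 - L x0)%:E.
have [|L1 [L2 [T1 [T2 [h [[L1c L2c T1p T2p] h_lin h_pos hk bnd]]]]]] :=
  @lagrange_multipliers L v L_lin reg _ _ _ _ _ Fx0 Cx0 Hx0 Gx0 Sz0 kw0.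
  move=> x f w z y Fx Cx Hx Gx Sz kw Kv.
  move: vsup; rewrite wsup_below => -[+ _]; apply.
  exists (- (f + y - L x)%:E)%E.
    exists (f + y - L x)%:E => //; exists x.
      by split => //=; rewrite Gx; exists (- z); rewrite ?opprK.
    by rewrite /kappa_comp Fx Hx /= kw.
  by apply/cone_ltE; rewrite opprK addrC.
exists L1 => //; exists L2 => //; exists T1; first split => //.
  (* Fixing the other arguments at the base point turns [bnd] into a bound on [h (T1 w - y)]. *)
  apply: (dom_conjugate_bounded h_lin h_pos hk (r := - h v - h ((L1 x0 - f0) +
    ((L x0 - L1 x0 - L2 x0) - (T1 w0 + T2 z0)) + L2 x0))) => //.
    by case: T1p.
  move=> w y kw; have := bnd _ _ _ _ _ _ _ _ Fx0 Hx0 Gx0 Cx0 kw.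
  by rewrite (scalar_add h_lin _ (T1 w - y)); lra.
exists T2 => //; exists (- v)%:E; last by rewrite /= opprK.
rewrite (dual_wsum K_cone K0 Kk) wsup_below; split.
  move=> [e eV ve].
  have [u [f [x [w [z [Fu Hx Gx [c [w' [y [Cc kw' eE]]]]]]]]]] :=
    dual_vals_elim eV ve.
  move: ve; rewrite eE => /cone_ltE /(scalar_interior_gt0 h_lin h_pos hk).
  rewrite (scalar_sub h_lin) (scalar_opp h_lin).
  by have := bnd _ _ _ _ _ _ _ _ Fu Hx Gx Cc kw'; lra.
move=> t tv; have : below K (-%E @` primal_vals S F kappa H G C L) t.
  by move: vsup; rewrite wsup_below => -[_ /(_ t tv)].
exact: below_primal.
Qed.

End multipliers.

Theorem corollary5p8 (R : realType) (X Y Z W : tvsType R)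
  (hX : hausdorff_space X) (hY : hausdorff_space Y)
  (hZ : hausdorff_space Z) (hW : hausdorff_space W)
  (K : set Y) (K_proper : K <> setT) (K_closed : closed K)
  (K_cone : convex_cone K) (K_int : K° !=set0)
  (P : set W) (P_neq0 : P !=set0) (P_cone : convex_cone P)
  (S : set Z) (S_neq0 : S !=set0) (S_cone : convex_cone S)
  (F : X -> option Y) (kappa : W -> option Y)
  (H : X -> option W) (G : X -> option Z)
  (F_proper : proper_map F) (kappa_proper : proper_map kappa)
  (H_proper : proper_map H) (G_proper : proper_map G)
  (C : set X) (C_neq0 : C !=set0)
  (A_dom : feasible S C G `&` dom F `&` [set x | top_mem (dom kappa) (H x)]
           !=set0)
  (F_convex : cone_convex K F) (H_convex : cone_convex P H)
  (G_convex : cone_convex S G) (kappa_convex : cone_convex K kappa)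
  (kappa_mono : cone_nondecreasing P K kappa)
  (C_convex : convex_set C)
  (* Not in the source, but implied by the conclusion (whose left-hand side is
     never empty), and false in general under the other hypotheses: for
     instance when kappa is a discontinuous linear functional. *)
  (kappa_dual : dom_conjugate K kappa !=set0)
  (reg : forall L : X -> Y, cont_lin L -> regularity K S C F kappa H G L) :
  forall L : X -> Y, cont_lin L ->
    primal K S C F kappa H G L = wmax K (dual K S C F kappa H G L) /\
    wmax K (dual K S C F kappa H G L) =
      wmax K (dual_pos K P S C F kappa H G L).
Proof.
move=> L L_lin; have [k Kk] := K_int.
have K0 : K 0.
  by apply: closed_cone0 => //; exists k; exact: interior_subset.
have nK0 : ~ K° 0 := interior_cone0 K_cone K_proper.
have strong := strong_duality K_cone K0 nK0 Kk P_cone P_neq0 S_cone S_neq0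
  F_convex H_convex G_convex kappa_convex kappa_mono C_convex kappa_proper
  kappa_dual A_dom L_lin (reg L L_lin).
have pos_sub := @dual_pos_sub _ _ _ _ _ K k K_cone K0 nK0 Kk P S S_cone S_neq0
  F kappa H G C L.
have weak := weak_duality K_cone K0 Kk.
(* The infimum is attained already in the smaller union and bounded by weak duality for the larger
   one, so [winf_wmax] applies to both. *)
have E1 : primal K S C F kappa H G L = wmax K (dual K S C F kappa H G L).
  apply: (winf_wmax K_cone K0 Kk); last by move=> v /strong; exact: pos_sub.
  by move=> v d; exact: weak.
have E2 : primal K S C F kappa H G L = wmax K (dual_pos K P S C F kappa H G L).
  apply: (winf_wmax K_cone K0 Kk) => // v d vM /pos_sub; exact: weak.
by split; rewrite -?E1.
Qed.
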